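(* Let $\beta_0,h_0\in\mathbb R$ be fixed and $X\sim P_{\beta_0,h_0}$. Suppose there is a finite constant $\gamma>0$ (independent of $N$) with $\max_{i\in[N]}\sum_{j,k}A_{ijk}\le\gamma$ for all $N$, and that the mean-field condition $\big\|\sum_iA_i^2\big\|_{\mathrm{op}}=o((\log N)^{-1})$ holds. Suppose that there exist constants $\varepsilon>0$ and $\delta>0$ such that, for all sufficiently large $N$, $$\sup_{\substack{y\in[\kappa_-,\kappa_+]^N\\ \sum_i(y_i-\bar y)^2\le\varepsilon N}}\big(f(y)-I(y)\big)\le\sup_{y\in[\kappa_-,\kappa_+]^N}\big(f(y)-I(y)\big)-\delta N,$$ where $f$ is taken with parameters $(\beta_0,h_0)$ and $\bar y=\frac1N\sum_iy_i$. Then there exists $c>0$ such that $$P_{\beta_0,h_0}\big(T_N(X)\ge c\big)\to1.$$ Consequently, the maximum pseudo-likelihood estimator is jointly $\sqrt N$-consistent at $(\beta_0,h_0)$.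
   Context: Setting. $\kappa_-<\kappa_+$ are real numbers, $\mu$ is a fixed probability measure on $[\kappa_-,\kappa_+]$ with $\kappa_-,\kappa_+\in\mathrm{supp}(\mu)$, and $\Lambda(\lambda)=\log\int e^{\lambda z}\,d\mu(z)$ for $\lambda\in\mathbb R$. For each $N$, $A=A^{(N)}=(A_{ijk})_{i,j,k\in[N]}$ is a 3-tensor with nonnegative entries, invariant under permutations of its indices, with $A_{ijk}=0$ unless $i,j,k$ are all distinct. $A_i=(A_{ijk})_{j,k\in[N]}$ is the $i$-th matrix slice. For $\beta,h\in\mathbb R$, $P_{\beta,h}$ is the probability measure on $[\kappa_-,\kappa_+]^N$ with density $$\frac{dP_{\beta,h}}{d\mu^{\otimes N}}(x)=\frac{e^{f(x)}}{Z_N(\beta,h)},\qquad f(x)=\frac{\beta}{3}\sum_{i,j,k}A_{ijk}x_ix_jx_k+h\sum_i x_i,$$ where $Z_N(\beta,h)$ is the normalizing constant. Put $m_i(x)=\sum_{j,k}A_{ijk}x_jx_k$, $\bar m(x)=\frac1N\sum_i m_i(x)$, $T_N(x)=\frac1N\sum_i(m_i(x)-\bar m(x))^2$. Rate function: for $t\in\mathbb R$, $I(t)=\sup_{\lambda\in\mathbb R}(\lambda t-\Lambda(\lambda))\in[0,\infty]$; for a vector $y$, $I(y)=\sum_iI(y_i)$. Maximum pseudo-likelihood estimator (MPLE): given $x$, $(\hat\beta,\hat h)$ is the unique solution $(\beta,h)\in\mathbb R^2$ of $$\sum_i m_i(x)\big(x_i-\Lambda'(\beta m_i(x)+h)\big)=0,\qquad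 \sum_i\big(x_i-\Lambda'(\beta m_i(x)+h)\big)=0;$$ it is said to exist if such a unique solution exists. It is jointly $\sqrt N$-consistent at $(\beta_0,h_0)$ if it exists with probability tending to one and $\max(|\hat\beta-\beta_0|,|\hat h-h_0|)=O_p(N^{-1/2})$ under $P_{\beta_0,h_0}$. All asymptotics are as $N\to\infty$. *)

(* Defs.v *)
From HB Require Import structures.
From mathcomp Require Import all_boot all_order all_algebra.
From mathcomp Require Import all_classical all_reals all_analysis.
Import Order.TTheory GRing.Theory Num.Theory.
Import numFieldNormedType.Exports.

Set Implicit Arguments.
Unset Strict Implicit.
Unset Printing Implicit Defensive.

Local Open Scope classical_set_scope.
Local Open Scope ring_scope.

Section product_probability.
Context d (T : measurableType d) (R : realType).

Definition cons_pair n (p : T * n.-tuple T) : n.+1.-tuple T :=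
  [tuple of p.1 :: p.2].

Let measurable_cons_pair n : measurable_fun setT (@cons_pair n).
Proof. exact: measurable_cons. Qed.

HB.instance Definition _ n :=
  isMeasurableFun.Build _ _ _ _ (@cons_pair n) (@measurable_cons_pair n).

(* The [n]-fold product measure; see [power_probE] for its value on boxes. *)
Fixpoint power_prob (mu : probability T R) n : probability (n.-tuple T) R :=
  if n is n'.+1 then
    distribution (mu \x power_prob mu n')%E (@cons_pair n')
  else \d_([tuple] : 0.-tuple T).

Lemma power_probE (mu : probability T R) n (B : 'I_n -> set T) :
  (forall i, measurable (B i)) ->
  power_prob mu n [set x | forall i, B i (tnth x i)] =
  (\prod_(i < n) mu (B i))%E.
Proof.
elim: n B => [|n IHn] B mB.
  by rewrite big_ord0 /= diracE mem_set // => -[].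
rewrite big_ord_recl -IHn // /= /distribution /= /pushforward /=.
rewrite -product_measure1E //; last first.
  rewrite [X in measurable X](_ : _ =
      \bigcap_(i : 'I_n) ((@tnth n T)^~ i @^-1` B (lift ord0 i))).
    by apply: fin_bigcap_measurable => // i _; rewrite -[X in measurable X]setTI;
      exact: measurable_tnth.
  by apply/seteqP; split => x /= h i; [move=> _|]; exact: h.
congr (_ _); apply/seteqP; split => -[a x] /=.
  move=> h; split; first exact: (h ord0).
  by move=> i; have := h (lift ord0 i); rewrite tnthS.
by move=> [ha hx] i; case: (unliftP ord0 i) => [j ->|->]; rewrite ?tnthS.
Qed.

End product_probability.

Definition msupport (R : realType) (mu : probability (measurableTypeR R) R) :
    set R :=
  [set x | forall U : set R, open U -> U x -> (0 < mu U)%E].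

Section euclidean_operator_norm.
Context (R : realType).

Definition l2norm n (v : 'cV[R]_n) : R := Num.sqrt (\sum_i v i 0 ^+ 2).

Definition opnorm n (M : 'M[R]_n) : R :=
  sup [set l2norm (M *m v) | v in [set v | l2norm v <= 1]].

End euclidean_operator_norm.

Section tensor.
Context (R : realType) (N : nat) (A : 'I_N -> 'I_N -> 'I_N -> R).

Definition symmetric_tensor := forall i j k,
  [/\ A i j k = A i k j, A i j k = A j i k, A i j k = A j k i,
      A i j k = A k i j & A i j k = A k j i].

Definition interaction_tensor :=
  [/\ forall i j k, 0 <= A i j k, symmetric_tensor &
      forall i j k, ~~ uniq [:: i; j; k] -> A i j k = 0].

Definition slice i : 'M[R]_N := \matrix_(j, k) A i j k.

Definition mean (y : 'I_N -> R) : R := N%:R^-1 * \sum_i y i.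

Definition sqdev (y : 'I_N -> R) : R := \sum_i (y i - mean y) ^+ 2.

Definition local_field (x : N.-tuple R) i : R :=
  \sum_j \sum_k A i j k * tnth x j * tnth x k.

Definition TN (x : N.-tuple R) : R := N%:R^-1 * sqdev (local_field x).

Definition hamiltonian (beta h : R) (x : N.-tuple R) : R :=
  beta / 3%:R *
    (\sum_i \sum_j \sum_k A i j k * tnth x i * tnth x j * tnth x k) +
  h * \sum_i tnth x i.

End tensor.

Section model.
Context (R : realType) (mu : probability (measurableTypeR R) R).

Definition logmgf (l : R) : R := ln (\int[mu]_z expR (l * z)).

Definition rate (t : R) : \bar R :=
  ereal_sup [set (l * t - logmgf l)%:E | l in [set: R]].

Context (N : nat) (A : 'I_N -> 'I_N -> 'I_N -> R).

Definition partition_function (beta h : R) : R :=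
  \int[power_prob mu N]_x expR (hamiltonian A beta h x).

Definition gibbs (beta h : R) (S : set (N.-tuple R)) : \bar R :=
  (\int[power_prob mu N]_(x in S)
     (expR (hamiltonian A beta h x) / partition_function beta h)%:E)%E.

Definition mean_field_sup (beta h : R) (D : set (N.-tuple R)) : \bar R :=
  ereal_sup
    [set ((hamiltonian A beta h y)%:E - \sum_i rate (tnth y i))%E | y in D].

(* [p] is the pair (beta, h). *)
Definition pl_equations (x : N.-tuple R) (p : R * R) : Prop :=
  let res i :=
    tnth x i - derive1 logmgf (p.1 * local_field A x i + p.2) in
  \sum_i local_field A x i * res i = 0 /\ \sum_i res i = 0.

Definition mple_exists (x : N.-tuple R) : Prop := exists! p, pl_equations x p.

(* Junk value (0, 0) when the MPLE does not exist. *)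
Definition mple (x : N.-tuple R) : R * R :=
  xget (0, 0) [set p | unique (pl_equations x) p].

End model.

Definition cube (R : realType) (a b : R) N : set (N.-tuple R) :=
  [set y | forall i, a <= tnth y i <= b].

Section asymptotics.
Context (R : realType) (mu : probability (measurableTypeR R) R).

(* Y_N = O_p(r_N) under the laws [P N]. *)
Definition bigOp (P : forall N, set (N.-tuple R) -> \bar R)
    (Y : forall N, N.-tuple R -> R) (r : nat -> R) : Prop :=
  forall eta : R, 0 < eta -> exists2 K : R, 0 < K &
    \forall N \near \oo,
      ((1 - eta)%:E <= P N [set x | (`|Y N x| <= K * r N)%R])%E.

Definition mple_sqrt_consistent (A : forall N, 'I_N -> 'I_N -> 'I_N -> R)
    (beta0 h0 : R) : Prop :=
  gibbs mu (A N) beta0 h0 [set x | mple_exists mu (A N) x]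
    @[N --> \oo] --> 1%E /\
  bigOp (fun N => gibbs mu (A N) beta0 h0)
    (fun N x => let p := mple mu (A N) x in
                Num.max `|p.1 - beta0| `|p.2 - h0|)
    (fun N => (Num.sqrt N%:R)^-1).

End asymptotics.

(* Main.v *)
(** Write [b_i = Lambda'(beta m_i + h)] for the conditional mean of [x_i] given
    the other coordinates and [R_ij = sum_k A_ijk].  Given the other
    coordinates, [x_i - b_i] is centered, so for the weights [w_i] equal to [1],
    [m_i], [sum_j R_ij x_j] and [sum_j R_ij], whose dependence on [x_j] is of
    order [R_ij], the residual [sum_i w_i (x_i - b_i)] has second moment
    [O(N)] under the Gibbs measure.

    If [TN] is small, all [m_i] are close to some [s] and all [b_i] to
    [t = Lambda'(l)] with [l = beta s + h].  Spending one residual per factor of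
    the cubic form replaces the spins by [t], so that
    [f(x) = f(t, ..., t) + o(N)] and [sum_i x_i = N t + o(N)]; tilting by
    [l sum_i x_i] then bounds the probability of this event by
    [exp (f(t, ..., t) - N I(t) - log Z + o(N))], and a finite grid of values
    [s] suffices.  Since [f] is affine in each coordinate, integrating one
    coordinate at a time gives [log Z >= sup (f - I)], and the gap hypothesis
    at the constant vector [(t, ..., t)] makes the bound exponentially small.

    On [TN >= c] the negative log pseudo-likelihood has curvature of order [N]
    near the true parameter, where its gradient is two of the residuals above,
    hence [O_p(sqrt N)]: its minimum over a square of side of order
    [1 / sqrt N] is interior. *)

Require Import Defs.
From HB Require Import structures.
From mathcomp Require Import all_boot all_order all_algebra.
From mathcomp Require Import all_classical all_reals all_analysis.
From mathcomp Require Import measurable_realfun ring lra.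
Import Order.TTheory GRing.Theory Num.Theory.
Import numFieldNormedType.Exports.

Set Implicit Arguments.
Unset Strict Implicit.
Unset Printing Implicit Defensive.

Local Open Scope classical_set_scope.
Local Open Scope ring_scope.

(** * Integration of functions bounded on a set of full measure *)

Section full_measure_domain.
Context d (T : measurableType d) (R : realType) (P : probability T R).
Variables (D : set T).
Hypotheses (mD : measurable D) (PD : P D = 1%E).
Implicit Types f g : T -> R.

(** Measurability is global but the bound is required only on [D]: polynomials in the spins are
    unbounded on the tuple space, yet bounded on the cube, which carries the measure. The class is
    stable under algebra and [expR], so integrability follows from the shape of the integrand. *)
Definition bounded_mfun f :=
  measurable_fun setT f /\ exists C, forall x, D x -> `|f x| <= C.

Lemma bounded_mfun_cst r : bounded_mfun (fun=> r).
Proof. by split; [exact: measurable_cst | exists `|r|]. Qed.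

Lemma bounded_mfunD f g :
  bounded_mfun f -> bounded_mfun g -> bounded_mfun (fun x => f x + g x).
Proof.
move=> [mf [C Cf]] [mg [C' Cg]]; split; first exact: measurable_funD.
exists (C + C') => x Dx; apply: le_trans (ler_normD _ _) _.
by rewrite lerD ?Cf ?Cg.
Qed.

Lemma bounded_mfunM f g :
  bounded_mfun f -> bounded_mfun g -> bounded_mfun (fun x => f x * g x).
Proof.
move=> [mf [C Cf]] [mg [C' Cg]]; split; first exact: measurable_funM.
by exists (C * C') => x Dx; rewrite normrM ler_pM ?Cf ?Cg.
Qed.

Lemma bounded_mfunZ r f : bounded_mfun f -> bounded_mfun (fun x => r * f x).
Proof. exact/bounded_mfunM/bounded_mfun_cst. Qed.

Lemma bounded_mfunB f g :
  bounded_mfun f -> bounded_mfun g -> bounded_mfun (fun x => f x - g x).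
Proof.
move=> bf /(bounded_mfunZ (-1)) bg.
rewrite (_ : (fun _ => _) = fun x => f x + -1 * g x); first exact: bounded_mfunD.
by apply/funext => x; rewrite mulN1r.
Qed.

Lemma bounded_mfunX f n : bounded_mfun f -> bounded_mfun (fun x => f x ^+ n).
Proof.
move=> bf; elim: n => [|n IHn]; first exact: bounded_mfun_cst.
by under eq_fun do rewrite exprS; exact: bounded_mfunM.
Qed.

Lemma bounded_mfun_sum I (s : seq I) (F : I -> T -> R) :
  (forall i, bounded_mfun (F i)) -> bounded_mfun (fun x => \sum_(i <- s) F i x).
Proof.
move=> bF; elim: s => [|i s IHs].
  by under eq_fun do rewrite big_nil; exact: bounded_mfun_cst.
by under eq_fun do rewrite big_cons; exact: bounded_mfunD.
Qed.

Lemma bounded_mfun_expR f : bounded_mfun f -> bounded_mfun (fun x => expR (f x)).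
Proof.
move=> [mf [C Cf]]; split; first exact: measurableT_comp.
exists (expR C) => x Dx; rewrite ger0_norm ?expR_ge0// ler_expR.
exact: le_trans (ler_norm _) (Cf _ Dx).
Qed.

Lemma bounded_mfun_indic (S : set T) : measurable S -> bounded_mfun \1_S.
Proof.
move=> mS; split; first exact: measurable_indic.
by exists 1 => x _; rewrite indicE; case: (_ \in _); rewrite ?normr1 ?normr0.
Qed.

Let PDC : P (~` D) = 0%E.
Proof. by rewrite probability_setC// PD subee. Qed.

Lemma integrable_bounded_mfun f :
  bounded_mfun f -> P.-integrable setT (EFin \o f).
Proof.
move=> [mf [C Cf]].
have mF : measurable_fun setT (EFin \o f) by exact/measurable_EFinP.
apply/(negligible_integrable (measurableC mD) measurableT mF PDC).
rewrite setTD setCK; apply: measurable_bounded_integrable => //.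
- by rewrite [X in (X < _)%E](_ : _ = 1%E)// ltry.
- exact: measurable_funTS.
- exists C; split; first exact: num_real.
  by move=> y Cy x Dx; exact: le_trans (Cf _ Dx) (ltW Cy).
Qed.

Lemma Rintegral_domain f :
  bounded_mfun f -> \int[P]_x f x = \int[P]_(x in D) f x.
Proof.
move=> /integrable_bounded_mfun intf.
by rewrite /Rintegral (negligible_integral (measurableC mD) _ intf)// setTD setCK.
Qed.

Lemma le_Rintegral_domain f g : bounded_mfun f -> bounded_mfun g ->
  (forall x, D x -> f x <= g x) -> \int[P]_x f x <= \int[P]_x g x.
Proof.
move=> bf bg fg; rewrite !Rintegral_domain//; apply: le_Rintegral => //.
- by apply: integrableS (integrable_bounded_mfun bf).
- by apply: integrableS (integrable_bounded_mfun bg).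
Qed.

Lemma Rintegral_prob_cst r : \int[P]_x (fun=> r) x = r.
Proof.
rewrite Rintegral_cst// [X in fine X](_ : _ = 1%E) ?mulr1//.
exact: probability_setT.
Qed.

Lemma bounded_RintegralD f g : bounded_mfun f -> bounded_mfun g ->
  \int[P]_x (f x + g x) = \int[P]_x f x + \int[P]_x g x.
Proof. by move=> bf bg; rewrite RintegralD//; exact: integrable_bounded_mfun. Qed.

Lemma bounded_RintegralB f g : bounded_mfun f -> bounded_mfun g ->
  \int[P]_x (f x - g x) = \int[P]_x f x - \int[P]_x g x.
Proof. by move=> bf bg; rewrite RintegralB//; exact: integrable_bounded_mfun. Qed.

Lemma bounded_RintegralZ r f : bounded_mfun f ->
  \int[P]_x (r * f x) = r * \int[P]_x f x.
Proof. by move=> bf; rewrite RintegralZl//; exact: integrable_bounded_mfun. Qed.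

Lemma bounded_Rintegral_sum I (s : seq I) (F : I -> T -> R) :
  (forall i, bounded_mfun (F i)) ->
  \int[P]_x (\sum_(i <- s) F i x) = \sum_(i <- s) \int[P]_x F i x.
Proof.
move=> bF; elim: s => [|i s IHs].
  by under eq_Rintegral do rewrite big_nil; rewrite big_nil Rintegral_prob_cst.
under eq_Rintegral do rewrite big_cons.
by rewrite bounded_RintegralD ?big_cons ?IHs//; exact: bounded_mfun_sum.
Qed.

Lemma Rintegral_expR_gt0 f : bounded_mfun f -> 0 < \int[P]_x expR (f x).
Proof.
move=> bf; have [_ [C Cf]] := bf.
apply: (@lt_le_trans _ _ (\int[P]_x (fun=> expR (- C)) x)).
  by rewrite Rintegral_prob_cst expR_gt0.
apply: le_Rintegral_domain => [||x Dx].
- exact: bounded_mfun_cst.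
- exact: bounded_mfun_expR.
- by rewrite ler_expR; have := Cf x Dx; rewrite ler_norml => /andP[].
Qed.

End full_measure_domain.

(** * Exponential tilts of a compactly supported measure *)

Section calculus.
Context (R : realType).
Implicit Types (f df ddf : R -> R) (a b c k L x y z : R).

Lemma is_derive_MVT f df a b : (forall x : R, is_derive x 1 f (df x)) -> a <= b ->
  exists2 c, a <= c <= b & f b - f a = df c * (b - a).
Proof.
move=> fd ab; have cf : {within `[a, b], continuous f}.
  by apply: derivable_within_continuous => x _; have [] := fd x.
have [c] := MVT_segment ab (fun x _ => fd x) cf.
by rewrite in_itv/=; exists c.
Qed.

Lemma derive_ge_sub f df k a b : (forall x : R, is_derive x 1 f (df x)) -> a <= b ->
  (forall x, a <= x <= b -> k <= df x) -> k * (b - a) <= f b - f a.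
Proof.
move=> fd ab kdf; have [c cab ->] := is_derive_MVT fd ab.
by rewrite ler_wpM2r ?subr_ge0 ?kdf.
Qed.

Lemma derive_le_sub f df k a b : (forall x : R, is_derive x 1 f (df x)) ->
  (forall x, `|df x| <= k) -> `|f b - f a| <= k * `|b - a|.
Proof.
move=> fd kdf; wlog ab : a b / a <= b => [hw|].
  by have [/hw//|/ltW/hw] := leP a b; rewrite distrC (distrC b).
have [c cab ->] := is_derive_MVT fd ab.
by rewrite normrM ler_wpM2r.
Qed.

(** Subtracting from [f] its linear part at [a] and the parabola [k / 2 * (x - a) ^+ 2] leaves a
    function whose derivative has the sign of [x - a] on [[-L, L]]. The curvature bound is local
    because the variance of a tilt is bounded below only for bounded tilts. *)
Lemma strongly_convex_tangent f df ddf L k a b :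
  (forall x : R, is_derive x 1 f (df x)) -> (forall x : R, is_derive x 1 df (ddf x)) ->
  (forall x, `|x| <= L -> k <= ddf x) -> `|a| <= L -> `|b| <= L ->
  f a + df a * (b - a) + k / 2 * (b - a) ^+ 2 <= f b.
Proof.
move=> fd dfd kddf aL bL.
pose g x := f x - df a * x - k / 2 * (x - a) ^+ 2.
pose dg x := df x - df a - k * (x - a).
have gd (x : R) : is_derive x 1 g (dg x).
  rewrite /g; apply: is_derive_eq; rewrite /dg /GRing.scale/=. lra.
have kdf x y : `|x| <= L -> `|y| <= L -> x <= y -> k * (y - x) <= df y - df x.
  rewrite !ler_norml => /andP[xL _] /andP[_ yL] xy.
  apply: (derive_ge_sub dfd xy) => z /andP[xz zy]; apply: kddf.
  by rewrite ler_norml (le_trans xL xz) (le_trans zy yL).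
suff : g a <= g b by rewrite /g; lra.
move: aL bL; have [ab|/ltW ba] := leP a b => aL bL.
  have [c /andP[ac cb] e] := is_derive_MVT gd ab.
  rewrite -subr_ge0 e; apply: mulr_ge0; rewrite subr_ge0//.
  by apply: kdf => //; move: aL bL; rewrite !ler_norml; lra.
have [c /andP[bc ca] e] := is_derive_MVT gd ba.
have cL : `|c| <= L by move: aL bL; rewrite !ler_norml; lra.
rewrite -subr_ge0 -opprB e -mulNr; apply: mulr_ge0; rewrite ?subr_ge0// /dg.
by have := kdf c a cL aL ca; lra.
Qed.

End calculus.

Lemma Rintegral_indic d (T : measurableType d) (R : realType)
    (P : probability T R) (S : set T) :
  measurable S -> \int[P]_x \1_S x = fine (P S).
Proof. by move=> mS; rewrite /Rintegral integral_indic// setIT. Qed.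

Section tilted_moments.
Context (R : realType) (mu : probability (measurableTypeR R) R).
Variables (km kp M : R).
Hypotheses (mu1 : mu [set` `[km, kp]] = 1%E).
Hypotheses (kmM : `|km| <= M) (kpM : `|kp| <= M).

Implicit Types (a b c l L x y z : R).

Let I : set R := [set` `[km, kp]].
Let mI : measurable (I : set (measurableTypeR R)).
Proof. exact: measurable_itv. Qed.

Lemma segment_norm z : km <= z <= kp -> `|z| <= M.
Proof. by move: kmM kpM; rewrite !ler_norml; lra. Qed.

Let M0 : 0 <= M. Proof. exact: le_trans kmM. Qed.

Lemma bounded_mfun_id : bounded_mfun I (fun z : measurableTypeR R => z).
Proof.
split; first exact: measurable_id.
by exists M => z; rewrite /I/= in_itv/=; exact: segment_norm.
Qed.

Lemma bounded_mfun_moment k l : bounded_mfun I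
  (fun z : measurableTypeR R => (z : R) ^+ k * expR (l * z)).
Proof.
apply: bounded_mfunM; first exact: bounded_mfunX bounded_mfun_id.
exact/bounded_mfun_expR/bounded_mfunZ/bounded_mfun_id.
Qed.

(** Unnormalized moments of the exponential tilt: differentiating in [l] raises [k] by one, so the
    first two derivatives of [logmgf] are rational in the moments [0], [1] and [2]. *)
Definition moment k l := \int[mu]_z ((z : R) ^+ k * expR (l * z)).

Lemma is_derive_moment k l : is_derive l 1 (moment k) (moment k.+1 l).
Proof.
pose f x (z : measurableTypeR R) := (z : R) ^+ k * expR (x * z).
have fd (z x : R) : is_derive x 1 (f ^~ z) (z ^+ k.+1 * expR (x * z)).
  rewrite /f; apply: is_derive_eq; rewrite /GRing.scale/= !mulr0 ?mul0r ?addr0 ?add0r.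
  by rewrite exprS; ring.
have d1f x z : partial1of2 f x z = z ^+ k.+1 * expR (x * z).
  by rewrite partial1of2E; have [_ ->] := fd z x.
have FE : moment k = fun x => \int[mu]_(z in I) f x z.
  apply/funext => x; rewrite /moment (Rintegral_domain mI mu1)//.
  exact: bounded_mfun_moment.
have lI : ([set` `]l - 1, l + 1[] : set R) l by rewrite /= in_itv/=; lra.
have h1 x : ([set` `]l - 1, l + 1[] : set R) x -> mu.-integrable I (EFin \o f x).
  move=> _; apply: (integrableS measurableT) => //.
  exact/(integrable_bounded_mfun mI mu1)/bounded_mfun_moment.
have h2 x y : ([set` `]l - 1, l + 1[] : set R) x -> I y -> derivable (f ^~ y) x 1.
  by move=> _ _; exact: ex_derive.
(* A dominating constant for the differentiated integrand, uniform over the tilts within distance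
   [1] of [l]. *)
pose C := M ^+ k.+1 * expR ((`|l| + 1) * M).
have h3 : mu.-integrable I (EFin \o (fun _ : measurableTypeR R => C)).
  apply: (integrableS measurableT) => //.
  exact/(integrable_bounded_mfun mI mu1)/bounded_mfun_cst.
have h4 x y : ([set` `]l - 1, l + 1[] : set R) x -> I y ->
    `|partial1of2 f x y| <= C.
  rewrite d1f /I /= !in_itv/= => xl /segment_norm yM.
  rewrite normrM normrX (ger0_norm (expR_ge0 _)) ler_pM ?expR_ge0 ?exprn_ge0//.
    by rewrite lerXn2r ?nnegrE.
  rewrite ler_expR (le_trans (ler_norm _))// normrM ler_pM//.
  have : - `|l| <= l <= `|l| by rewrite -ler_norml.
  by rewrite ler_norml; lra.
have C0 (_ : measurableTypeR R) : 0 <= C by rewrite mulr_ge0 ?expR_ge0 ?exprn_ge0.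
have dF := derivable_under_integral mI lI h1 h2 C0 h3 h4.
have eF := differentiation_under_integral mI lI h1 h2 C0 h3 h4.
rewrite FE; apply: DeriveDef => //.
rewrite -derive1E eF /moment (Rintegral_domain mI mu1).
  by apply: eq_Rintegral => z _; rewrite d1f.
exact: bounded_mfun_moment.
Qed.

Lemma moment0_gt0 l : 0 < moment 0 l.
Proof.
rewrite /moment; under eq_Rintegral do rewrite mul1r.
apply: (Rintegral_expR_gt0 mI mu1).
exact/bounded_mfunZ/bounded_mfun_id.
Qed.

Lemma logmgfE : logmgf mu = @ln R \o moment 0.
Proof.
apply/funext => l; rewrite /logmgf /moment/=; congr ln.
by apply: eq_Rintegral => z _; rewrite mul1r.
Qed.

(** This is [Lambda'(l)], and [tilted_var] below is [Lambda''(l)]. *)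
Definition tilted_mean l := moment 1 l / moment 0 l.

Definition tilted_var l := moment 2 l / moment 0 l - tilted_mean l ^+ 2.

Lemma is_derive_logmgf l : is_derive l 1 (logmgf mu) (tilted_mean l).
Proof.
rewrite logmgfE; have := is_derive1_comp (is_derive1_ln (moment0_gt0 l))
  (is_derive_moment 0 l).
by rewrite /tilted_mean mulrC.
Qed.

Lemma derive1_logmgf : derive1 (logmgf mu) = tilted_mean.
Proof.
by apply/funext => l; rewrite derive1E; have [_ ->] := is_derive_logmgf l.
Qed.

Lemma is_derive_tilted_mean l : is_derive l 1 tilted_mean (tilted_var l).
Proof.
have n0 : moment 0 l != 0 by rewrite gt_eqF ?moment0_gt0.
have := is_deriveM (is_derive_moment 1 l) (is_deriveV n0 (is_derive_moment 0 l)).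
rewrite /tilted_mean (_ : moment 1 * _ = fun l => moment 1 l / moment 0 l)//.
move=> h; apply: (is_derive_eq h).
by rewrite /tilted_var /tilted_mean /GRing.scale/=; field.
Qed.

Lemma continuous_tilted_mean : continuous tilted_mean.
Proof.
move=> l; apply/differentiable_continuous/derivable1_diffP.
by have [] := is_derive_tilted_mean l.
Qed.

Lemma Rintegral_sqr_tilted c l :
  \int[mu]_z (((z : R) - c) ^+ 2 * expR (l * z)) =
  moment 2 l - 2 * c * moment 1 l + c ^+ 2 * moment 0 l.
Proof.
rewrite /moment -!(bounded_RintegralZ mI mu1 _ (bounded_mfun_moment _ _)).
rewrite -(bounded_RintegralB mI mu1) -?(bounded_RintegralD mI mu1).
- by apply: eq_Rintegral => z _; ring.
- apply: bounded_mfunB; first exact: bounded_mfun_moment.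
  exact/bounded_mfunZ/bounded_mfun_moment.
- exact/bounded_mfunZ/bounded_mfun_moment.
- exact: bounded_mfun_moment.
- exact/bounded_mfunZ/bounded_mfun_moment.
Qed.

Lemma tilted_varE l : tilted_var l =
  (\int[mu]_z (((z : R) - tilted_mean l) ^+ 2 * expR (l * z))) / moment 0 l.
Proof.
rewrite Rintegral_sqr_tilted /tilted_var /tilted_mean.
by have := gt_eqF (moment0_gt0 l) => /negbT; move=> n0; field.
Qed.

(** The source of all cancellation between residuals: a spin minus its tilted mean is centered under
    the tilt. *)
Lemma tilted_mean_orth l :
  \int[mu]_z (((z : R) - tilted_mean l) * expR (l * z)) = 0.
Proof.
transitivity (moment 1 l - tilted_mean l * moment 0 l); last first.
  by rewrite /tilted_mean divfK ?subrr// gt_eqF ?moment0_gt0.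
rewrite /moment -!(bounded_RintegralZ mI mu1 _ (bounded_mfun_moment _ _)).
rewrite -(bounded_RintegralB mI mu1).
- by apply: eq_Rintegral => z _; ring.
- exact: bounded_mfun_moment.
- exact/bounded_mfunZ/bounded_mfun_moment.
Qed.

Lemma tilted_mean_segment l : km <= tilted_mean l <= kp.
Proof.
rewrite /tilted_mean ler_pdivlMr ?ler_pdivrMr ?moment0_gt0//.
rewrite /moment -!(bounded_RintegralZ mI mu1 _ (bounded_mfun_moment _ _)).
have bm := bounded_mfun_moment; have bz a := bounded_mfunZ a (bm 0 l).
apply/andP; split.
  apply: (le_Rintegral_domain mI mu1) (bz _) (bm _ _) _ => z.
  rewrite /I/= in_itv/= => /andP[kz _].
  by rewrite mul1r expr1 ler_wpM2r ?expR_ge0.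
apply: (le_Rintegral_domain mI mu1) (bm _ _) (bz _) _ => z.
rewrite /I/= in_itv/= => /andP[_ zk].
by rewrite mul1r expr1 ler_wpM2r ?expR_ge0.
Qed.

Lemma tilted_mean_norm l : `|tilted_mean l| <= M.
Proof. exact/segment_norm/tilted_mean_segment. Qed.

Lemma tilted_var_ge0 l : 0 <= tilted_var l.
Proof.
rewrite tilted_varE divr_ge0//; last exact/ltW/moment0_gt0.
by apply: Rintegral_ge0 => z _; rewrite mulr_ge0 ?sqr_ge0 ?expR_ge0.
Qed.

Lemma tilted_var_norm l : `|tilted_var l| <= M ^+ 2.
Proof.
rewrite ger0_norm ?tilted_var_ge0//.
rewrite /tilted_var (@le_trans _ _ (moment 2 l / moment 0 l))//.
  by rewrite lerBlDr lerDl sqr_ge0.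
rewrite ler_pdivrMr ?moment0_gt0// /moment.
rewrite -(bounded_RintegralZ mI mu1 _ (bounded_mfun_moment _ _)).
have bm := bounded_mfun_moment.
apply: (le_Rintegral_domain mI mu1) (bm _ _) (bounded_mfunZ _ (bm _ _)) _ => z.
rewrite /I/= in_itv/= => /segment_norm zM.
by rewrite mul1r ler_wpM2r ?expR_ge0// -real_normK ?num_real// lerXn2r ?nnegrE.
Qed.

Lemma tilted_mean_Lipschitz a b :
  `|tilted_mean b - tilted_mean a| <= M ^+ 2 * `|b - a|.
Proof. exact: derive_le_sub is_derive_tilted_mean tilted_var_norm. Qed.

Lemma rate_tilted_mean l :
  rate mu (tilted_mean l) = (l * tilted_mean l - logmgf mu l)%:E.
Proof.
apply/eqP; rewrite eq_le; apply/andP; split; last first.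
  by apply: ereal_sup_ubound; exists l.
apply: ge_ereal_sup => _ [b _ <-]; rewrite lee_fin.
(* Plain convexity, that is curvature [0], puts [logmgf] above its tangent at [l], so the supremum
   is attained there; the radius only has to cover [l] and [b]. *)
have := @strongly_convex_tangent _ _ _ _ (`|l| + `|b|) 0 l b is_derive_logmgf
  is_derive_tilted_mean (fun x _ => tilted_var_ge0 x).
rewrite lerDl lerDr !normr_ge0 => /(_ isT isT).
rewrite !mul0r addr0 mulrBr !(mulrC (tilted_mean l)).
have aux (u v p q : R) : u + (p - q) <= v -> p - v <= q - u by lra.
exact: aux.
Qed.

Hypotheses (kmkp : km < kp) (skm : msupport mu km) (skp : msupport mu kp).

(** Both endpoints carry mass in every neighborhood. With windows of radius [q], a quarter of the
    width, any [c] is at distance at least [q] from the whole window at the endpoint on the other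
    side of the midpoint. *)
Lemma support_sqr_ge :
  exists2 v : R, 0 < v & forall c, v <= \int[mu]_z ((z : R) - c) ^+ 2.
Proof.
pose q := (kp - km) / 4; have q0 : 0 < q by rewrite divr_gt0 ?subr_gt0.
have kpE : kp = km + q * 4 by rewrite divfK ?pnatr_eq0// subrKC.
have le_sqr w : q <= w -> q ^+ 2 <= w ^+ 2.
  by move=> qw; rewrite lerXn2r ?nnegrE ?(ltW q0)// (le_trans (ltW q0)).
pose U k : set R := [set` `]k - q, k + q[].
have mU k : measurable (U k : set (measurableTypeR R)) by exact: measurable_itv.
pose p k := fine (mu (U k)).
have p_gt0 k : msupport mu k -> 0 < p k.
  move=> /(_ (U k)) h; apply: fine_gt0; rewrite h ?ltey_eq ?fin_num_measure//.
  by rewrite /U/= in_itv/= gtrBl ltrDl q0.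
have low k c : (forall z, U k z -> q ^+ 2 <= (z - c) ^+ 2) ->
    q ^+ 2 * p k <= \int[mu]_z ((z : R) - c) ^+ 2.
  move=> h; rewrite /p -Rintegral_indic//.
  have bi := bounded_mfun_indic R I (mU k).
  rewrite -(bounded_RintegralZ mI mu1 _ bi).
  have b2 := bounded_mfunX 2 (bounded_mfunB bounded_mfun_id
    (bounded_mfun_cst I c)).
  apply: (le_Rintegral_domain mI mu1) (bounded_mfunZ _ bi) b2 _ => z _.
  rewrite indicE; have [/set_mem/h|_] := boolP (z \in U k).
    by rewrite mulr1.
  by rewrite mulr0 sqr_ge0.
exists (q ^+ 2 * Num.min (p km) (p kp)).
  by rewrite mulr_gt0 ?exprn_gt0// lt_min !p_gt0.
move=> c; have [cm|cm] := leP ((km + kp) / 2) c.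
  apply: le_trans (low km c _); first by rewrite ler_wpM2l ?sqr_ge0// ge_min lexx.
  move=> z; rewrite /U/= in_itv/= => zU.
  rewrite -[(z - c) ^+ 2]sqrrN opprB; apply: le_sqr.
  by move: zU cm; rewrite kpE; clearbody q; lra.
apply: le_trans (low kp c _).
  by rewrite ler_wpM2l ?sqr_ge0// ge_min lexx orbT.
move=> z; rewrite /U/= in_itv/= => zU.
apply: le_sqr.
by move: zU (ltW cm); rewrite kpE; clearbody q; lra.
Qed.

(** On the segment the weight [expR (l * z)] lies between [expR (- (L * M))] and [expR (L * M)], so
    tilting changes second moments by a bounded factor. The center [tilted_mean l] moves with [l],
    which is why [support_sqr_ge] is uniform in [c]. *)
Lemma tilted_var_lower L :
  exists2 k : R, 0 < k & forall l, `|l| <= L -> k <= tilted_var l.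
Proof.
have [v v0 hv] := support_sqr_ge.
exists (v * expR (- (L * M)) / expR (L * M)).
  by rewrite !mulr_gt0 ?invr_gt0 ?expR_gt0.
move=> l lL; rewrite tilted_varE.
have lz z : I z -> `|l * z| <= L * M.
  by rewrite /I/= in_itv/= => /segment_norm zM; rewrite normrM ler_pM.
have b2 := bounded_mfunX 2 (bounded_mfunB bounded_mfun_id
  (bounded_mfun_cst I (tilted_mean l))).
have be : bounded_mfun I (fun z : measurableTypeR R => expR (l * z)).
  exact/bounded_mfun_expR/bounded_mfunZ/bounded_mfun_id.
rewrite ler_pM ?mulr_ge0 ?invr_ge0 ?expR_ge0// ?(ltW v0)//.
  rewrite (le_trans (ler_wpM2r (expR_ge0 _) (hv (tilted_mean l))))// mulrC.
  rewrite -(bounded_RintegralZ mI mu1 _ b2).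
  apply: (le_Rintegral_domain mI mu1) (bounded_mfunZ _ b2)
    (bounded_mfunM b2 be) _ => z.
  move=> /lz; rewrite ler_norml => /andP[lzM _].
  by rewrite mulrC ler_wpM2l ?sqr_ge0// ler_expR.
rewrite lef_pV2 ?posrE ?expR_gt0 ?moment0_gt0//.
rewrite -[leRHS](@Rintegral_prob_cst _ _ _ mu) /moment.
apply: (le_Rintegral_domain mI mu1).
- exact: bounded_mfun_moment.
- exact: bounded_mfun_cst.
- by move=> z /lz; rewrite ler_norml mul1r ler_expR => /andP[].
Qed.

Lemma tilted_mean_increasing a b : a < b -> tilted_mean a < tilted_mean b.
Proof.
move=> ab; have [k k0 hk] := tilted_var_lower (`|a| + `|b|).
rewrite -subr_gt0.
apply: lt_le_trans (derive_ge_sub is_derive_tilted_mean (ltW ab) _).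
  by apply: (mulr_gt0 k0); rewrite subr_gt0.
move=> x /andP[ax xb]; apply: hk.
have : - `|a| <= a <= `|a| by rewrite -ler_norml.
have : - `|b| <= b <= `|b| by rewrite -ler_norml.
by rewrite ler_norml; have := normr_ge0 a; have := normr_ge0 b; lra.
Qed.

End tilted_moments.

(** * Resampling one coordinate of a product measure *)

Section coordinate_update.
Context d (T : measurableType d).

Definition upd n (x : n.-tuple T) (i : 'I_n) (z : T) : n.-tuple T :=
  [tuple (if j == i then z else tnth x j) | j < n].

Lemma tnth_upd n (x : n.-tuple T) i z j :
  tnth (upd x i z) j = if j == i then z else tnth x j.
Proof. by rewrite tnth_mktuple. Qed.

Lemma upd_cons0 n a (x : n.-tuple T) z :
  upd (cons_pair (a, x)) ord0 z = cons_pair (z, x).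
Proof.
apply: eq_from_tnth => j; rewrite tnth_upd.
by case: (unliftP ord0 j) => [k ->|->]; rewrite ?tnthS ?tnth0.
Qed.

Lemma upd_consS n a (x : n.-tuple T) i z :
  upd (cons_pair (a, x)) (lift ord0 i) z = cons_pair (a, upd x i z).
Proof.
apply: eq_from_tnth => j; rewrite tnth_upd.
case: (unliftP ord0 j) => [k ->|->]; last by rewrite !tnth0.
by rewrite !tnthS (inj_eq lift_inj) tnth_upd.
Qed.

Lemma measurable_upd n (i : 'I_n) :
  measurable_fun setT (fun p : n.-tuple T * T => upd p.1 i p.2).
Proof.
apply/measurable_fun_tnthP => j; rewrite /comp.
under eq_fun do rewrite tnth_upd.
case: (j == i); first exact: measurable_snd.
by apply: measurableT_comp (measurable_tnth j) _; exact: measurable_fst.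
Qed.

End coordinate_update.

Section resampling.
Context d (T : measurableType d) (R : realType) (mu : probability T R).
Local Open Scope ereal_scope.

Lemma ge0_integral_power_probS n (G : n.+1.-tuple T -> \bar R) :
  measurable_fun setT G -> (forall x, 0 <= G x) ->
  \int[power_prob mu n.+1]_x G x =
  \int[mu]_a \int[power_prob mu n]_x G (cons_pair (a, x)).
Proof.
move=> mG G0; rewrite /= /distribution ge0_integral_pushforward//=.
rewrite preimage_setT.
have mGc : measurable_fun setT (G \o @cons_pair _ T n).
  by apply: measurableT_comp => //; exact: measurable_funP.
by rewrite (fubini_tonelli1 (G \o @cons_pair _ T n))// => p; exact: G0.
Qed.

(** Induction on the position of [i]. At the head, the resampled integrand ignores the old first
    entry, whose integral is then that of a constant, and Tonelli reorders the rest; a later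
    position is handled inside the tail. *)
Lemma ge0_integral_resample n (i : 'I_n) (G : n.-tuple T -> \bar R) :
  measurable_fun setT G -> (forall x, 0 <= G x) ->
  \int[power_prob mu n]_x G x =
  \int[power_prob mu n]_x \int[mu]_z G (upd x i z).
Proof.
elim: n i G => [[]//|n IHn] i G mG G0.
have mGu : measurable_fun setT (fun p => G (upd p.1 i p.2)).
  exact: measurableT_comp mG (measurable_upd i).
have mGc : measurable_fun setT (fun p => G (cons_pair p)).
  by apply: measurableT_comp => //; exact: measurable_funP.
rewrite !ge0_integral_power_probS//; last 2 first.
- exact: (measurable_fun_fubini_tonelli_F (m2 := mu) _ mGu (fun p => G0 _)).
- by move=> x; exact: integral_ge0.
case: (unliftP ord0 i) => [j|] ->; last first.
  under [RHS]eq_integral do under eq_integral do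
    under eq_integral do rewrite upd_cons0.
  rewrite integral_cst//.
  rewrite [X in _ = _ * X](_ : _ = 1) ?mule1; last exact: probability_setT.
  by rewrite (fubini_tonelli (fun p => G (cons_pair p))).
apply: eq_integral => a _; rewrite (IHn j).
- by under [RHS]eq_integral do under eq_integral do rewrite upd_consS.
- by apply: measurableT_comp mGc _; exact: measurable_pair1.
- by [].
Qed.

(** The product measure is the image of itself times [mu] under [upd]: the nonnegative case on
    indicators shows this, and Fubini then covers integrands of either sign. *)
Lemma integral_resample n (i : 'I_n) (G : n.-tuple T -> \bar R) :
  (power_prob mu n).-integrable setT G ->
  \int[power_prob mu n]_x G x =
  \int[power_prob mu n]_x \int[mu]_z G (upd x i z).
Proof.
move=> /integrableP[mG Goo].
pose phi (p : n.-tuple T * T) := upd p.1 i p.2.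
have mphi : measurable_fun setT phi by exact: measurable_upd.
have iG : (power_prob mu n \x mu).-integrable setT (G \o phi).
  apply/integrableP; split; first exact: measurableT_comp.
  rewrite (fubini_tonelli1 (fun p => `|G (phi p)|))//; last first.
    by apply: measurableT_comp => //; exact: measurableT_comp.
  rewrite -(ge0_integral_resample i (G := fun x => `|G x|))//.
  exact: measurableT_comp.
rewrite (eq_measure_integral (pushforward (power_prob mu n \x mu) phi)).
  rewrite (integral_pushforward mphi mG) ?preimage_setT//.
  by rewrite -(integral12_prod_meas1 iG).
move=> A mA _.
have mI : measurable_fun setT (fun p => (\1_A (phi p))%:E : \bar R).
  by apply/measurable_EFinP; apply: measurableT_comp mphi; exact: measurable_indic.
transitivity (\int[power_prob mu n]_x (\1_A x)%:E : \bar R).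
  by rewrite integral_indic// setIT.
rewrite (ge0_integral_resample i)//; last first.
  by apply/measurable_EFinP; exact: measurable_indic.
have := fubini_tonelli1 (m1 := power_prob mu n) (m2 := mu) _ mI (fun p => _).
rewrite /fubini_F /phi /= => <- => [|p]; last by rewrite lee_fin.
rewrite (_ : (fun _ => _) = fun p => (\1_(phi @^-1` A) p)%:E)//.
rewrite integral_indic ?setIT//.
by rewrite -[X in measurable X]setTI; exact: mphi.
Qed.

End resampling.

(** * Exponential integrals over the product measure *)

Section power_measure.
Context (R : realType) (mu : probability (measurableTypeR R) R).
Variables (km kp M : R).
Hypotheses (mu1 : mu [set` `[km, kp]] = 1%E).
Hypotheses (kmM : `|km| <= M) (kpM : `|kp| <= M).
Implicit Types (N : nat) (l r z : R).

Let I : set R := [set` `[km, kp]].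
Let mI : measurable (I : set (measurableTypeR R)).
Proof. exact: measurable_itv. Qed.

Local Notation tup N := (N.-tuple (measurableTypeR R)).
Local Notation Pw N := (power_prob mu N).
Local Notation Q N := (@cube R km kp N : set (tup N)).

Lemma cubeE N : cube km kp (N := N) = [set x | forall i, I (tnth x i)].
Proof. by apply/seteqP; split => x h i; have := h i; rewrite /I/= in_itv. Qed.

Lemma measurable_cube N : measurable (Q N).
Proof.
rewrite cubeE [X in measurable X](_ : _ =
    \bigcap_(i : 'I_N) ((@tnth N (measurableTypeR R))^~ i @^-1` I)).
  apply: fin_bigcap_measurable => // i _; rewrite -[X in measurable X]setTI.
  exact: measurable_tnth.
by apply/seteqP; split => x h i; [move=> _|]; exact: h.
Qed.

Lemma power_prob_cube N : Pw N (Q N) = 1%E.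
Proof.
rewrite cubeE; apply: etrans (power_probE mu (fun _ : 'I_N => mI)) _.
by rewrite big1.
Qed.

Lemma cube_norm N (x : tup N) i : Q N x -> `|tnth x i| <= M.
Proof. by move=> /(_ i); exact: segment_norm. Qed.

Lemma cube_upd N (x : tup N) i z :
  Q N x -> km <= z <= kp -> Q N (upd x i z).
Proof. by move=> cx cz j; rewrite tnth_upd; case: eqP. Qed.

Lemma bounded_mfun_tnth N (i : 'I_N) :
  bounded_mfun (Q N) (fun x : tup N => tnth x i : R).
Proof.
split; first exact: measurable_tnth.
by exists M => x /cube_norm.
Qed.

Lemma bounded_mfun_tilted_mean N (f : tup N -> R) :
  bounded_mfun (Q N) f ->
  bounded_mfun (Q N) (fun x => tilted_mean mu (f x)).
Proof.
move=> [mf _]; split; last first.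
  by exists M => x _; exact: (tilted_mean_norm mu1).
apply: measurableT_comp mf; apply: continuous_measurable_fun.
exact: (continuous_tilted_mean mu1 kmM kpM).
Qed.

Lemma integral_expR_lin l r :
  (\int[mu]_z (expR (r + l * z))%:E = (expR (r + logmgf mu l))%:E)%E.
Proof.
have be : bounded_mfun I (fun z : measurableTypeR R => expR (r + l * z)).
  apply/bounded_mfun_expR/bounded_mfunD; first exact: bounded_mfun_cst.
  exact/bounded_mfunZ/(bounded_mfun_id kmM kpM).
have := integrable_fin_num measurableT (integrable_bounded_mfun mI mu1 be).
move=> /fineK <-; congr (_%:E); rewrite -[LHS]/(\int[mu]_z expR (r + l * z)).
rewrite /logmgf expRD lnK; last first.
  rewrite posrE; apply: (Rintegral_expR_gt0 mI mu1).
  exact/bounded_mfunZ/(bounded_mfun_id kmM kpM).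
under eq_Rintegral do rewrite expRD.
rewrite (bounded_RintegralZ mI mu1)//.
exact/bounded_mfun_expR/bounded_mfunZ/(bounded_mfun_id kmM kpM).
Qed.

Lemma integral_expR_sum N l :
  (\int[Pw N]_x (expR (l * \sum_i tnth x i))%:E =
   (expR (N%:R * logmgf mu l))%:E)%E.
Proof.
have mS n : measurable_fun setT
    (fun x : tup n => (expR (l * \sum_i tnth x i))%:E : \bar R).
  apply/measurable_EFinP; apply: measurableT_comp => //.
  apply: measurable_funM => //; apply: measurable_sum => i.
  exact: measurable_tnth.
elim: N => [|n IHn].
  rewrite integral_dirac//; last exact: mS.
  by rewrite diracE mem_set// mul1e big_ord0 mulr0 mul0r.
apply: etrans (ge0_integral_power_probS mu (mS n.+1) _) _.
  by move=> x; rewrite lee_fin expR_ge0.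
transitivity (\int[mu]_a (expR (n%:R * logmgf mu l + l * a))%:E)%E; last first.
  by rewrite integral_expR_lin -natr1 mulrDl mul1r.
apply: eq_integral => a _.
rewrite addrC expRD EFinM -IHn -ge0_integralZl_EFin ?expR_ge0//; last exact: mS.
apply: eq_integral => x _; rewrite -EFinM -expRD -mulrDr big_ord_recl tnth0.
by under eq_bigr do rewrite tnthS.
Qed.

(** Given the other coordinates, the density [expR H] is an exponential in [x_i] with rate [lam x],
    so the conditional mean of [x_i] is the tilted mean at [lam x]; the factor [c] is constant under
    this conditioning. *)
Lemma tilted_coordinate_orth N (i : 'I_N) (H c lam : tup N -> R) :
  bounded_mfun (Q N) H -> bounded_mfun (Q N) c ->
  bounded_mfun (Q N) lam ->
  (forall x z, H (upd x i z) = H (upd x i 0) + lam x * z) ->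
  (forall x z, lam (upd x i z) = lam x) -> (forall x z, c (upd x i z) = c x) ->
  \int[Pw N]_x (c x * (tnth x i - tilted_mean mu (lam x)) * expR (H x)) = 0.
Proof.
move=> bH bc bl HE lE cE; rewrite /Rintegral (integral_resample i); last first.
  apply: (integrable_bounded_mfun (@measurable_cube N) (@power_prob_cube N)).
  apply: bounded_mfunM; last exact: bounded_mfun_expR.
  apply: bounded_mfunM bc _; apply: bounded_mfunB; first exact: bounded_mfun_tnth.
  exact: bounded_mfun_tilted_mean.
rewrite integral0_eq// => x _.
pose t := tilted_mean mu (lam x); pose C := c x * expR (H (upd x i 0)).
have bz : bounded_mfun I (fun z : measurableTypeR R => (z - t) * expR (lam x * z)).
  have bid := bounded_mfun_id kmM kpM.
  apply: bounded_mfunM; last exact/bounded_mfun_expR/bounded_mfunZ.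
  exact/bounded_mfunB/bounded_mfun_cst.
have bC := bounded_mfunZ C bz.
transitivity (\int[mu]_z (C * ((z - t) * expR (lam x * z)))%:E)%E.
  apply: eq_integral => z _; congr (_%:E).
  by rewrite cE lE tnth_upd eqxx HE expRD /C /t; ring.
have := integrable_fin_num measurableT (integrable_bounded_mfun mI mu1 bC).
move=> /fineK <-; congr (_%:E).
rewrite -[LHS]/(\int[mu]_z (C * ((z - t) * expR (lam x * z)))).
rewrite (bounded_RintegralZ mI mu1)//.
by rewrite (tilted_mean_orth mu1 kmM kpM) mulr0.
Qed.

(* Integrating one coordinate of [exp H] costs at most the rate of its new
   value, because [H] is affine in that coordinate. *)
Lemma integral_expR_freeze N (i : 'I_N) (H lam : tup N -> R) (y r : R) :
  measurable_fun setT H ->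
  (forall x z, H (upd x i z) = H (upd x i 0) + lam x * z) ->
  (forall l, l * y - logmgf mu l <= r) ->
  (\int[Pw N]_x (expR (H (upd x i y) - r))%:E <= \int[Pw N]_x (expR (H x))%:E)%E.
Proof.
move=> mH HE hr.
have mE : measurable_fun setT (fun x : tup N => (expR (H x))%:E : \bar R).
  by apply/measurable_EFinP; exact: measurableT_comp.
rewrite [leRHS](ge0_integral_resample mu i)//.
apply: ge0_le_integral => //.
- apply/measurable_EFinP; apply: measurableT_comp => //.
  apply: measurable_funB => //; apply: measurableT_comp mH _.
  have := @measurable_upd _ (measurableTypeR R) N i => mu2.
  exact: (measurableT_comp mu2 (pair2_measurable y)).
- have mEu := measurableT_comp mE (measurable_upd i).
  apply: (measurable_fun_fubini_tonelli_F (m2 := mu) _ mEu) => p.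
  by rewrite lee_fin expR_ge0.
move=> x _; under eq_integral do rewrite HE.
rewrite integral_expR_lin lee_fin ler_expR (HE x y).
by have := hr (lam x); lra.
Qed.

Definition coordinate_affine N (H : tup N -> R) (lam : 'I_N -> tup N -> R) :=
  forall i x z, H (upd x i z) = H (upd x i 0) + lam i x * z.

(** The mean-field lower bound on a partition function: the coordinates are frozen at the entries of
    [y] one after another, each at the cost [r i], until the integrand is constant. *)
Lemma integral_expR_rate N (H : tup N -> R) lam (y : tup N) (r : 'I_N -> R) :
  measurable_fun setT H -> coordinate_affine H lam ->
  (forall i l, l * tnth y i - logmgf mu l <= r i) ->
  ((expR (H y - \sum_i r i))%:E <= \int[Pw N]_x (expR (H x))%:E)%E.
Proof.
move=> mH HE hr.
pose fill (s : seq 'I_N) (x : tup N) : tup N :=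
  [tuple (if j \in s then tnth y j else tnth x j) | j < N].
have tfill s x j : tnth (fill s x) j = if j \in s then tnth y j else tnth x j.
  by rewrite tnth_mktuple.
have mfill s : measurable_fun setT (fill s).
  apply/measurable_fun_tnthP => j; rewrite /comp.
  under eq_fun do rewrite tfill.
  by case: (j \in s); [exact: measurable_cst | exact: measurable_tnth].
have key (s : seq 'I_N) : uniq s ->
    (\int[Pw N]_x (expR (H (fill s x) - \sum_(i <- s) r i))%:E <=
     \int[Pw N]_x (expR (H x))%:E)%E.
  elim: s => [_|i s IHs /= /andP[nis /IHs]]; last first.
    apply: le_trans; rewrite big_cons.
    have hu x z : fill s (upd x i z) = upd (fill s x) i z.
      apply: eq_from_tnth => j; rewrite !(tfill, tnth_upd).
      by case: eqP => [->|//]; rewrite (negbTE nis).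
    pose G x := H (fill s x) - \sum_(j <- s) r j.
    have := @integral_expR_freeze N i G (fun x => lam i (fill s x)) (tnth y i) (r i).
    rewrite /G => h; apply: le_trans (h _ _ _); last 3 first.
    - by apply: measurable_funB => //; exact: measurableT_comp.
    - by move=> x z; rewrite !hu HE; ring.
    - exact: hr.
    apply: ge0_le_integral => //.
    - apply/measurable_EFinP; apply: measurableT_comp => //.
      by apply: measurable_funB => //; exact: measurableT_comp.
    - apply/measurable_EFinP; apply: measurableT_comp => //.
      apply: measurable_funB => //; apply: measurable_funB => //.
      apply: measurableT_comp mH _; apply: measurableT_comp (mfill s) _.
      have := @measurable_upd _ (measurableTypeR R) N i => mu2.
      exact: (measurableT_comp mu2 (pair2_measurable (tnth y i))).
    move=> x _; rewrite lee_fin ler_expR.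
    rewrite (_ : fill s (upd x i (tnth y i)) = fill (i :: s) x); first lra.
    apply: eq_from_tnth => j; rewrite !(tfill, tnth_upd) in_cons.
    by case: eqP => [->|//]; rewrite (negbTE nis).
  rewrite big_nil; under eq_integral do rewrite subr0.
  rewrite le_eqVlt; apply/orP; left; apply/eqP; apply: eq_integral => x _.
  congr (expR (H _))%:E; apply: eq_from_tnth => j; rewrite tfill.
  by rewrite in_nil.
have := key (enum 'I_N) (enum_uniq _); rewrite big_enum /=.
under eq_integral => x _.
  rewrite (_ : fill (enum 'I_N) x = y); last first.
    by apply: eq_from_tnth => j; rewrite tfill mem_enum.
  over.
rewrite integral_cst// [X in (_ * X <= _)%E](_ : _ = 1%E) ?mule1//.
exact: probability_setT.
Qed.

End power_measure.

(** * Second moment of the residuals *)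

Section residual_second_moment.
Context (R : realType) (mu : probability (measurableTypeR R) R).
Variables (km kp M : R).
Hypotheses (mu1 : mu [set` `[km, kp]] = 1%E).
Hypotheses (kmM : `|km| <= M) (kpM : `|kp| <= M).
Variable N : nat.

Local Notation tup := (N.-tuple (measurableTypeR R)).
Local Notation Pw := (power_prob mu N).
Local Notation Q := (@cube R km kp N : set tup).

Variables (H : tup -> R) (lam : 'I_N -> tup -> R).
Hypothesis bH : bounded_mfun Q H.
Hypothesis blam : forall i, bounded_mfun Q (lam i).
Hypothesis H_affine : coordinate_affine H lam.
Hypothesis lam_upd : forall i x z, lam i (upd x i z) = lam i x.
Variables (D : 'I_N -> 'I_N -> R) (gamma Kl C : R).
Hypotheses (D_ge0 : forall i j, 0 <= D i j).
Hypotheses (D_sum : forall i, \sum_j D i j <= gamma).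
Hypothesis Kl_ge0 : 0 <= Kl.
Hypothesis lam_osc : forall i j x z, Q x -> km <= z <= kp -> i != j ->
  `|lam j (upd x i z) - lam j x| <= Kl * D i j.
Variable w : 'I_N -> tup -> R.
Hypothesis mw : forall i, measurable_fun setT (w i).
Hypothesis w_le : forall i x, Q x -> `|w i x| <= C.
Hypothesis w_upd : forall i x z, w i (upd x i z) = w i x.
Hypothesis w_osc : forall i j x z, Q x -> km <= z <= kp -> i != j ->
  `|w j (upd x i z) - w j x| <= C * D i j.

(** Here [D i j] measures the influence of coordinate [i] on both the slope and the weight at [j];
    its bounded row sums encode weak dependence. *)
Definition residual i x := w i x * (tnth x i - tilted_mean mu (lam i x)).

Let mQ : measurable Q. Proof. exact: measurable_cube. Qed.
Let PQ : Pw Q = 1%E. Proof. exact: power_prob_cube. Qed.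

Let M_ge0 : 0 <= M. Proof. exact: le_trans kmM. Qed.

Let bw i : bounded_mfun Q (w i).
Proof. by split => //; exists C; exact: w_le. Qed.

Lemma bounded_mfun_residual i : bounded_mfun Q (residual i).
Proof.
apply: bounded_mfunM => //; apply: bounded_mfunB.
  exact: (bounded_mfun_tnth kmM kpM).
exact: (bounded_mfun_tilted_mean mu1 kmM kpM).
Qed.

Let centered_le i x : Q x -> `|tnth x i - tilted_mean mu (lam i x)| <= 2 * M.
Proof.
move=> Qx; have := cube_norm kmM kpM i Qx.
have := tilted_mean_norm mu1 kmM kpM (lam i x).
by rewrite !ler_norml; lra.
Qed.

Let residual_le i x : Q x -> `|residual i x| <= 2 * M * C.
Proof.
by move=> Qx; rewrite normrM mulrC ler_pM// ?centered_le// w_le.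
Qed.

(** Sensitivity of a residual to another coordinate: the first term comes from its weight, the
    second from its conditional mean, as [tilted_mean] is [M ^+ 2]-Lipschitz. *)
Let K := 2 * M * C + C * (M ^+ 2 * Kl).

Let C_ge0 (i : 'I_N) x : Q x -> 0 <= C.
Proof. by move=> Qx; apply: le_trans (w_le i Qx). Qed.

Let residual_osc i j x z : Q x -> km <= z <= kp -> i != j ->
  `|residual j x - residual j (upd x i z)| <= K * D i j.
Proof.
move=> Qx kz ij; rewrite /residual tnth_upd eq_sym (negbTE ij).
set x' := upd x i z; set t := tilted_mean mu.
rewrite (_ : _ - _ = (w j x - w j x') * (tnth x j - t (lam j x)) +
  w j x' * (t (lam j x') - t (lam j x))); last first.
  by move: (t (lam j x)) (t (lam j x')) => s s'; ring.
have Qx' : Q x' by exact: cube_upd.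
apply: le_trans (ler_normD _ _) _; rewrite !normrM /K mulrDl lerD//.
  by rewrite [leRHS](_ : _ = C * D i j * (2 * M)) ?ler_pM ?centered_le//;
    [rewrite distrC w_osc | ring].
rewrite -mulrA ler_pM ?w_le//.
have := tilted_mean_Lipschitz mu1 kmM kpM (lam j x) (lam j x').
move=> /le_trans; apply; rewrite -mulrA ler_wpM2l ?sqr_ge0//.
exact: lam_osc.
Qed.

Let be : bounded_mfun Q (fun x => expR (H x)).
Proof. exact: bounded_mfun_expR. Qed.

Let km_seg : km <= km <= kp.
Proof.
rewrite lexx leNgt; apply/negP => kk.
have : mu [set` `[km, kp]] = 0%E.
  by rewrite set_itv_ge ?measure0// bnd_simp -ltNge.
by rewrite mu1 => /eqP; rewrite onee_eq0.
Qed.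

(* Freezing coordinate [i] inside the [j]-th factor makes the product of the
   two residuals centered given the other coordinates. *)
Lemma residual_cross i j : i != j ->
  \int[Pw]_x (residual i x * residual j x * expR (H x)) <=
  2 * M * C * (K * D i j) * \int[Pw]_x expR (H x).
Proof.
move=> ij; pose g x := residual j (upd x i km).
have mg : measurable_fun setT g.
  apply: measurableT_comp (proj1 (bounded_mfun_residual j)) _.
  exact: (measurableT_comp (@measurable_upd _ (measurableTypeR R) N i)
    (pair2_measurable km)).
have bg : bounded_mfun Q g.
  by split => //; exists (2 * M * C) => x Qx; exact/residual_le/cube_upd.
have br := bounded_mfun_residual.
have b1 := bounded_mfunM (bounded_mfunM (br i) bg) be.
have b2 := bounded_mfunM (bounded_mfunM (br i) (bounded_mfunB (br j) bg)) be.
have b3 := bounded_mfunM (bounded_mfunM (br i) (br j)) be.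
have zero : \int[Pw]_x (residual i x * g x * expR (H x)) = 0.
  pose c x := w i x * g x.
  have bc := bounded_mfunM (bw i) bg.
  have cE x z : c (upd x i z) = c x.
    rewrite /c w_upd; congr (_ * residual j _); apply: eq_from_tnth => k.
    by rewrite !tnth_upd; case: eqP.
  rewrite -[RHS](tilted_coordinate_orth mu1 kmM kpM bH bc (blam i)
    (H_affine i) (lam_upd i) cE).
  by apply: eq_Rintegral => x _; rewrite /c /residual; ring.
have -> : \int[Pw]_x (residual i x * residual j x * expR (H x)) =
    \int[Pw]_x (residual i x * (residual j x - g x) * expR (H x)).
  rewrite -[LHS]subr0 -zero -(bounded_RintegralB mQ PQ b3 b1).
  by apply: eq_Rintegral => x _; rewrite -mulrBl -mulrBr.
rewrite -(bounded_RintegralZ mQ PQ _ be).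
apply: (le_Rintegral_domain mQ PQ) b2 (bounded_mfunZ _ be) _ => x Qx.
rewrite ler_wpM2r ?expR_ge0// (le_trans (ler_norm _))// normrM.
by rewrite ler_pM ?residual_le ?residual_osc.
Qed.

Lemma residual_diag i :
  \int[Pw]_x (residual i x * residual i x * expR (H x)) <=
  (2 * M * C) ^+ 2 * \int[Pw]_x expR (H x).
Proof.
rewrite -(bounded_RintegralZ mQ PQ _ be).
have br := bounded_mfun_residual i.
apply: (le_Rintegral_domain mQ PQ) (bounded_mfunM (bounded_mfunM br br) be)
  (bounded_mfunZ _ be) _ => x Qx.
rewrite ler_wpM2r ?expR_ge0// (le_trans (ler_norm _))// normrM -expr2.
by rewrite lerXn2r ?nnegrE ?residual_le// (le_trans _ (residual_le i Qx)).
Qed.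

(** Expanding the square gives [N] diagonal terms of order one, while the cross terms in row [i] are
    of order [D i j] and sum to a constant; hence order [N] instead of [N^2]. *)
Lemma residual_second_moment :
  \int[Pw]_x ((\sum_i residual i x) ^+ 2 * expR (H x)) <=
  ((2 * M * C) ^+ 2 + 2 * M * C * K * gamma) * N%:R * \int[Pw]_x expR (H x).
Proof.
have br := bounded_mfun_residual.
have Z0 : 0 < \int[Pw]_x expR (H x) by exact: (Rintegral_expR_gt0 mQ PQ).
have brr i j : bounded_mfun Q (fun x => residual i x * residual j x * expR (H x)).
  by apply: bounded_mfunM => //; exact: bounded_mfunM.
have -> : \int[Pw]_x ((\sum_i residual i x) ^+ 2 * expR (H x)) =
    \sum_i \sum_j \int[Pw]_x (residual i x * residual j x * expR (H x)).
  under [RHS]eq_bigr do rewrite -(bounded_Rintegral_sum mQ PQ)//.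
  rewrite -(bounded_Rintegral_sum mQ PQ); last first.
    by move=> i; exact: bounded_mfun_sum.
  apply: eq_Rintegral => x _; rewrite expr2 big_distrlr/= big_distrl/=.
  by apply: eq_bigr => i _; rewrite big_distrl.
(* The sign of [C] is read off from a weight evaluated at a point of the cube, the constant tuple
   [km]; an index is needed to have a weight at all. *)
have C0 (i : 'I_N) : 0 <= C.
  apply: (@C_ge0 i [tuple of nseq N km]) => j.
  by rewrite (tnth_nth km) nth_nseq ltn_ord.
have row i : \sum_j \int[Pw]_x (residual i x * residual j x * expR (H x)) <=
    ((2 * M * C) ^+ 2 + 2 * M * C * K * gamma) * \int[Pw]_x expR (H x).
  have K0 : 0 <= K by rewrite /K addr_ge0 ?mulr_ge0 ?(C0 i)// exprn_ge0.
  (* The indicator merges the diagonal and off-diagonal bounds into a single summand. *)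
  apply: (@le_trans _ _ (\sum_j ((2 * M * C) ^+ 2 * (j == i)%:R +
    2 * M * C * (K * D i j)) * \int[Pw]_x expR (H x))).
    apply: ler_sum => j _; have [->|ji] := eqVneq j i.
      apply: le_trans (residual_diag i) _; rewrite ler_wpM2r ?(ltW Z0)//.
      by rewrite mulr1 lerDl !mulr_ge0 ?(C0 i).
    by rewrite mulr0 add0r; apply: residual_cross; rewrite eq_sym.
  rewrite -mulr_suml ler_wpM2r ?(ltW Z0)// big_split/= -!mulr_sumr.
  rewrite (bigD1 i)//= big1 => [|j /negbTE->//]; rewrite eqxx addr0 mulr1.
  by rewrite lerD2l mulrA ler_wpM2l// !mulr_ge0 ?(C0 i).
apply: le_trans (ler_sum _ (fun i _ => row i)) _.
by rewrite sumr_const card_ord -[leLHS]mulr_natl mulrA (mulrC N%:R).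
Qed.

End residual_second_moment.

(** * The cubic Hamiltonian *)

Section tensor_model.
Context (R : realType) (N : nat) (A : 'I_N -> 'I_N -> 'I_N -> R).
Hypothesis hA : interaction_tensor A.
Variable gamma : R.
Hypothesis hrow : forall i, \sum_j \sum_k A i j k <= gamma.

Local Notation tup := (N.-tuple (measurableTypeR R)).
Local Notation m := (local_field A).

Let A_ge0 i j k : 0 <= A i j k. Proof. by case: hA. Qed.

Let A_swap12 i j k : A i j k = A j i k.
Proof. by case: hA => _ /(_ i j k)[]. Qed.

Let A_swap23 i j k : A i j k = A i k j.
Proof. by case: hA => _ /(_ i j k)[]. Qed.

Let A_rot i j k : A i j k = A j k i.
Proof. by case: hA => _ /(_ i j k)[]. Qed.

Let A0 i j k : ~~ uniq [:: i; j; k] -> A i j k = 0.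
Proof. by case: hA => _ _; exact. Qed.

Let Aiik i k : A i i k = 0.
Proof. by apply: A0; rewrite /= !inE eqxx. Qed.

Let Aiji i j : A i j i = 0.
Proof. by apply: A0; rewrite /= !inE eqxx orbT. Qed.

Let Aijj i j : A i j j = 0.
Proof. by apply: A0; rewrite /= !inE eqxx andbF. Qed.

Definition pair_degree i j := \sum_k A i j k.

Definition degree i := \sum_j pair_degree i j.

(** The weight obtained from [local_field] when one of its two spins is replaced by [1]; replacing
    both gives [degree]. *)
Definition linear_field (x : tup) i : R := \sum_j pair_degree i j * tnth x j.

Lemma pair_degree_ge0 i j : 0 <= pair_degree i j.
Proof. exact: sumr_ge0. Qed.

Lemma pair_degreeC i j : pair_degree i j = pair_degree j i.
Proof. by apply: eq_bigr => k _; rewrite A_swap12. Qed.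

Lemma pair_degree_diag i : pair_degree i i = 0.
Proof. by apply: big1 => k _; exact: Aiik. Qed.

Lemma degree_ge0 i : 0 <= degree i.
Proof. by apply: sumr_ge0 => j _; exact: pair_degree_ge0. Qed.

Lemma degree_le i : degree i <= gamma. Proof. exact: hrow. Qed.

Lemma local_field_upd (x : tup) i z : m (upd x i z) i = m x i.
Proof.
apply: eq_bigr => j _; apply: eq_bigr => k _; rewrite !tnth_upd.
case: eqP => [->|_]; first by rewrite Aiik !mul0r.
by case: eqP => [->|//]; rewrite Aiji !mul0r.
Qed.

Lemma linear_field_upd (x : tup) i z : linear_field (upd x i z) i = linear_field x i.
Proof.
apply: eq_bigr => j _; rewrite tnth_upd.
by case: eqP => [->|//]; rewrite pair_degree_diag !mul0r.
Qed.

Lemma sum_delta1 (F : 'I_N -> 'I_N -> 'I_N -> R) i :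
  \sum_a \sum_b \sum_c (a == i)%:R * F a b c = \sum_b \sum_c F i b c.
Proof.
rewrite (bigD1 i)//= [X in _ + X]big1 ?addr0 => [|a /negbTE ->].
  by apply: eq_bigr => b _; apply: eq_bigr => c _; rewrite eqxx mul1r.
by apply: big1 => b _; apply: big1 => c _; rewrite mul0r.
Qed.

Lemma hamiltonianE beta h (x : tup) : hamiltonian A beta h x =
  beta / 3 * (\sum_i m x i * tnth x i) + h * \sum_i tnth x i.
Proof.
rewrite /hamiltonian; congr (_ * _ + _); apply: eq_bigr => i _.
rewrite mulr_suml; apply: eq_bigr => j _; rewrite mulr_suml.
by apply: eq_bigr => k _; ring.
Qed.

(** Entries with a repeated index vanish, so the cubic form is affine in each spin. By symmetry the
    index [i] contributes equally in each of its three positions, which cancels the factor [1/3]. *)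
Lemma hamiltonian_upd beta h (x : tup) i z : hamiltonian A beta h (upd x i z) =
  hamiltonian A beta h (upd x i 0) + (beta * m x i + h) * z.
Proof.
rewrite /hamiltonian.
have -> : \sum_a tnth (upd x i z) a = \sum_a tnth (upd x i 0) a + z :> R.
  rewrite (bigD1 i)//= [in RHS](bigD1 i)//= !tnth_upd !eqxx add0r addrC.
  congr (_ + _); apply: eq_bigr => a ai.
  by rewrite !tnth_upd (negbTE ai).
have -> : \sum_a \sum_b \sum_c
      A a b c * tnth (upd x i z) a * tnth (upd x i z) b * tnth (upd x i z) c =
    \sum_a \sum_b \sum_c A a b c * tnth (upd x i 0) a * tnth (upd x i 0) b *
      tnth (upd x i 0) c + 3 * z * m x i :> R.
  have e1 : \sum_a \sum_b \sum_c (a == i)%:R * (A a b c * tnth x b * tnth x c) =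
      m x i by rewrite sum_delta1.
  have e2 : \sum_a \sum_b \sum_c (b == i)%:R * (A a b c * tnth x a * tnth x c) =
      m x i.
    rewrite exchange_big/= sum_delta1.
    by apply: eq_bigr => b _; apply: eq_bigr => c _; rewrite A_swap12.
  have e3 : \sum_a \sum_b \sum_c (c == i)%:R * (A a b c * tnth x a * tnth x b) =
      m x i.
    under eq_bigr do rewrite exchange_big/=.
    rewrite exchange_big/= sum_delta1.
    by apply: eq_bigr => b _; apply: eq_bigr => c _; rewrite -A_rot.
  rewrite (_ : 3 * z * m x i = z * (m x i + m x i + m x i)); last by ring.
  rewrite -{1}e1 -{1}e2 -{1}e3 -!big_split/= mulr_sumr -big_split/=.
  apply: eq_bigr => a _; rewrite -!big_split/= mulr_sumr -big_split/=.
  apply: eq_bigr => b _; rewrite -!big_split/= mulr_sumr -big_split/=.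
  apply: eq_bigr => c _; rewrite !tnth_upd.
  case: (eqVneq a i) => [->|ai]; case: (eqVneq b i) => [->|bi];
  case: (eqVneq c i) => [->|ci]; rewrite /= ?Aiik ?Aiji ?Aijj; ring.
have n3 : (3 : R) != 0 by rewrite pnatr_eq0.
by field.
Qed.

(** Re-rooting the triple sum at one of the remaining spins turns the total weight left after one
    replacement into a weighted spin sum, ready for the next replacement. [sum_linear_field_degree]
    does the same one factor later. *)
Lemma sum_local_field_linear (x : tup) :
  \sum_i m x i = \sum_i linear_field x i * tnth x i.
Proof.
rewrite /local_field exchange_big/=; apply: eq_bigr => j _.
rewrite exchange_big/= /linear_field mulr_suml; apply: eq_bigr => k _.
rewrite /pair_degree !mulr_suml; apply: eq_bigr => i _.
by rewrite A_rot; ring.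
Qed.

Lemma sum_linear_field_degree (x : tup) :
  \sum_i linear_field x i = \sum_i degree i * tnth x i.
Proof.
rewrite /linear_field exchange_big/=; apply: eq_bigr => j _.
by rewrite -mulr_suml; congr (_ * _); apply: eq_bigr => i _; exact: pair_degreeC.
Qed.

Lemma hamiltonian_const beta h t : hamiltonian A beta h [tuple t | _ < N] =
  beta / 3 * (t ^+ 3 * \sum_i degree i) + h * (t * N%:R).
Proof.
rewrite /hamiltonian; congr (_ * _ + _ * _); last first.
  under eq_bigr do rewrite tnth_mktuple.
  by rewrite sumr_const card_ord mulr_natr.
rewrite mulr_sumr; apply: eq_bigr => i _; rewrite /degree mulr_sumr.
apply: eq_bigr => j _; rewrite /pair_degree mulr_sumr.
by apply: eq_bigr => k _; rewrite !tnth_mktuple; ring.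
Qed.

Variables (km kp M : R).
Hypotheses (kmM : `|km| <= M) (kpM : `|kp| <= M).
Local Notation Q := (@cube R km kp N : set tup).

Let M_ge0 : 0 <= M. Proof. exact: le_trans kmM. Qed.

Lemma local_field_le i x : Q x -> `|m x i| <= gamma * M ^+ 2.
Proof.
move=> Qx; rewrite (le_trans _ (ler_wpM2r (sqr_ge0 M) (hrow i)))//.
rewrite mulr_suml; apply: le_trans (ler_norm_sum _ _ _) (ler_sum _ _) => j _.
rewrite mulr_suml; apply: le_trans (ler_norm_sum _ _ _) (ler_sum _ _) => k _.
rewrite -mulrA !normrM (ger0_norm (A_ge0 _ _ _)) ler_wpM2l// expr2.
by rewrite ler_pM// (cube_norm kmM kpM _ Qx).
Qed.

Lemma linear_field_le i x : Q x -> `|linear_field x i| <= gamma * M.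
Proof.
move=> Qx; rewrite (le_trans _ (ler_wpM2r M_ge0 (hrow i)))//.
rewrite mulr_suml; apply: le_trans (ler_norm_sum _ _ _) (ler_sum _ _) => j _.
rewrite normrM (ger0_norm (pair_degree_ge0 _ _)) ler_wpM2l ?pair_degree_ge0//.
exact: (cube_norm kmM kpM _ Qx).
Qed.

Let upd_osc i j x z : Q x -> km <= z <= kp ->
  `|tnth (upd x i z) j - tnth x j| <= 2 * M * (j == i)%:R.
Proof.
move=> Qx kz; rewrite tnth_upd; case: eqP => _; last by rewrite subrr normr0 mulr0.
have := cube_norm kmM kpM j Qx; have := segment_norm kmM kpM kz.
by rewrite mulr1 !ler_norml; lra.
Qed.

Lemma linear_field_osc i j x z : Q x -> km <= z <= kp ->
  `|linear_field (upd x i z) j - linear_field x j| <= 2 * M * pair_degree i j.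
Proof.
move=> Qx kz; rewrite /linear_field -sumrB.
apply: (@le_trans _ _ (\sum_k pair_degree j k * (2 * M * (k == i)%:R))).
  apply: le_trans (ler_norm_sum _ _ _) (ler_sum _ _) => k _.
  rewrite -mulrBr normrM (ger0_norm (pair_degree_ge0 _ _)).
  by rewrite ler_wpM2l ?pair_degree_ge0// upd_osc.
rewrite (bigD1 i)//= big1 => [|k /negbTE ->]; last by rewrite !mulr0.
by rewrite eqxx pair_degreeC mulr1 addr0 mulrC.
Qed.

Lemma local_field_osc i j x z : Q x -> km <= z <= kp ->
  `|m (upd x i z) j - m x j| <= 4 * M ^+ 2 * pair_degree i j.
Proof.
move=> Qx kz; rewrite /local_field -sumrB.
(* A product of two spins changes only if one of them sits at [i]; that spin moves by at most
   [2 * M] and the other factor is at most [M]. *)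
pose F a b := A j a b * (2 * M ^+ 2 * (a == i)%:R + 2 * M ^+ 2 * (b == i)%:R).
apply: (@le_trans _ _ (\sum_a \sum_b F a b)).
  apply: le_trans (ler_norm_sum _ _ _) (ler_sum _ _) => a _; rewrite -sumrB.
  apply: le_trans (ler_norm_sum _ _ _) (ler_sum _ _) => b _.
  rewrite -!mulrA -mulrBr normrM (ger0_norm (A_ge0 _ _ _)) ler_wpM2l//.
  set x' := upd x i z.
  rewrite (_ : _ - _ = (tnth x' a - tnth x a) * tnth x' b +
    tnth x a * (tnth x' b - tnth x b)); last by ring.
  have Qx' : Q x' by exact: cube_upd.
  apply: le_trans (ler_normD _ _) _; rewrite !normrM lerD//.
    rewrite [leRHS](_ : _ = 2 * M * (a == i)%:R * M); last by ring.
    by rewrite ler_pM ?upd_osc ?(cube_norm kmM kpM _ Qx').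
  rewrite [leRHS](_ : _ = M * (2 * M * (b == i)%:R)); last by ring.
  by rewrite ler_pM ?upd_osc ?(cube_norm kmM kpM _ Qx).
have h1 c : \sum_a \sum_b A j a b * (c * (a == i)%:R) = c * pair_degree i j.
  rewrite (bigD1 i)//= [X in _ + X]big1 => [|a /negbTE ->]; last first.
    by apply: big1 => b _; rewrite !mulr0.
  by rewrite addr0 eqxx mulr1 -mulr_suml mulrC pair_degreeC.
have h2 c : \sum_a \sum_b A j a b * (c * (b == i)%:R) = c * pair_degree i j.
  rewrite -h1 exchange_big/=.
  by apply: eq_bigr => b _; apply: eq_bigr => a _; rewrite A_swap23.
rewrite /F; under eq_bigr do (under eq_bigr do rewrite mulrDr; rewrite big_split/=).
by rewrite big_split/= h1 h2 -mulrDl -mulrDl -natrD.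
Qed.

End tensor_model.

(** * Residuals and energy under the Gibbs measure *)

Section gibbs_model.
Context (R : realType) (mu : probability (measurableTypeR R) R).
Variables (km kp M : R).
Hypotheses (mu1 : mu [set` `[km, kp]] = 1%E).
Hypotheses (kmM : `|km| <= M) (kpM : `|kp| <= M).
Variables (N : nat) (A : 'I_N -> 'I_N -> 'I_N -> R).
Hypothesis hA : interaction_tensor A.
Variables (gamma beta h : R).
Hypothesis hrow : forall i, \sum_j \sum_k A i j k <= gamma.
Hypothesis gamma_ge0 : 0 <= gamma.

Local Notation tup := (N.-tuple (measurableTypeR R)).
Local Notation Pw := (power_prob mu N).
Local Notation Q := (@cube R km kp N : set tup).
Local Notation m := (local_field A).
Local Notation f := (hamiltonian A beta h : tup -> R).
Local Notation Z := (partition_function mu A beta h).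

Let mQ : measurable Q. Proof. exact: measurable_cube. Qed.
Let PQ : Pw Q = 1%E. Proof. exact: power_prob_cube. Qed.
Let M_ge0 : 0 <= M. Proof. exact: le_trans kmM. Qed.
Let bt i := bounded_mfun_tnth kmM kpM i : bounded_mfun Q _.

Lemma bounded_mfun_local_field i : bounded_mfun Q (fun x => m x i).
Proof.
apply: bounded_mfun_sum => j; apply: bounded_mfun_sum => k.
by apply: bounded_mfunM => //; exact: bounded_mfunZ.
Qed.

Lemma bounded_mfun_linear_field i : bounded_mfun Q (fun x => linear_field A x i).
Proof. by apply: bounded_mfun_sum => j; exact: bounded_mfunZ. Qed.

Lemma bounded_mfun_hamiltonian : bounded_mfun Q f.
Proof.
rewrite (_ : f = fun x => beta / 3 * (\sum_i m x i * tnth x i) +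
  h * \sum_i tnth x i); last by apply/funext => x; exact: hamiltonianE.
apply: bounded_mfunD; apply: bounded_mfunZ; apply: bounded_mfun_sum => i //.
by apply: bounded_mfunM => //; exact: bounded_mfun_local_field.
Qed.

Let be : bounded_mfun Q (fun x => expR (f x)).
Proof. exact/bounded_mfun_expR/bounded_mfun_hamiltonian. Qed.

Lemma partition_function_gt0 : 0 < Z.
Proof. exact: (Rintegral_expR_gt0 mQ PQ bounded_mfun_hamiltonian). Qed.

Definition gibbs_mean (phi : tup -> R) := (\int[Pw]_x (phi x * expR (f x))) / Z.

Let bmul phi : bounded_mfun Q phi -> bounded_mfun Q (fun x => phi x * expR (f x)).
Proof. by move=> bphi; exact: bounded_mfunM. Qed.

Lemma le_gibbs_mean phi psi : bounded_mfun Q phi -> bounded_mfun Q psi ->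
  (forall x, Q x -> phi x <= psi x) -> gibbs_mean phi <= gibbs_mean psi.
Proof.
move=> bphi bpsi h12; rewrite ler_wpM2r ?invr_ge0 ?(ltW partition_function_gt0)//.
apply: (le_Rintegral_domain mQ PQ) (bmul bphi) (bmul bpsi) _ => x Qx.
by rewrite ler_wpM2r ?expR_ge0 ?h12.
Qed.

Lemma gibbs_meanB phi psi : bounded_mfun Q phi -> bounded_mfun Q psi ->
  gibbs_mean (fun x => phi x - psi x) = gibbs_mean phi - gibbs_mean psi.
Proof.
move=> bphi bpsi; rewrite /gibbs_mean -mulrBl.
rewrite -(bounded_RintegralB mQ PQ (bmul bphi) (bmul bpsi)).
by congr (_ / _); apply: eq_Rintegral => x _; rewrite mulrBl.
Qed.

Lemma gibbs_meanD phi psi : bounded_mfun Q phi -> bounded_mfun Q psi ->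
  gibbs_mean (fun x => phi x + psi x) = gibbs_mean phi + gibbs_mean psi.
Proof.
move=> bphi bpsi; rewrite /gibbs_mean -mulrDl.
rewrite -(bounded_RintegralD mQ PQ (bmul bphi) (bmul bpsi)).
by congr (_ / _); apply: eq_Rintegral => x _; rewrite mulrDl.
Qed.

Lemma gibbs_meanZ r phi : bounded_mfun Q phi ->
  gibbs_mean (fun x => r * phi x) = r * gibbs_mean phi.
Proof.
move=> bphi; rewrite /gibbs_mean mulrA.
rewrite -(bounded_RintegralZ mQ PQ _ (bmul bphi)).
by congr (_ / _); apply: eq_Rintegral => x _; rewrite mulrA.
Qed.

Lemma gibbs_mean_cst r : gibbs_mean (fun=> r) = r.
Proof.
rewrite /gibbs_mean (bounded_RintegralZ mQ PQ _ be).
by rewrite -/Z mulfK// gt_eqF ?partition_function_gt0.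
Qed.

Lemma gibbs_mean_sum I (s : seq I) (F : I -> tup -> R) :
  (forall i, bounded_mfun Q (F i)) ->
  gibbs_mean (fun x => \sum_(i <- s) F i x) = \sum_(i <- s) gibbs_mean (F i).
Proof.
move=> bF; elim: s => [|i s IHs].
  by under [X in gibbs_mean X]eq_fun do rewrite big_nil; rewrite big_nil gibbs_mean_cst.
under [X in gibbs_mean X]eq_fun do rewrite big_cons.
by rewrite gibbs_meanD ?IHs ?big_cons//; exact: bounded_mfun_sum.
Qed.

(* [gibbs] is an integral of a nonnegative function, that is a supremum of
   integrals of simple functions, so it is monotone even on nonmeasurable
   sets. *)
Lemma le_gibbs (S S' : set tup) :
  S `<=` S' -> (gibbs mu A beta h S <= gibbs mu A beta h S')%E.
Proof.
move=> SS'; rewrite /gibbs.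
have g0 (x : tup) : (0 <= (expR (f x) / Z)%:E)%E.
  by rewrite lee_fin divr_ge0 ?expR_ge0 ?(ltW partition_function_gt0).
rewrite !ge0_integralE//; apply: le_ereal_sup => _ [u /= hu <-].
exists u => // x; apply: le_trans (hu x) _; rewrite !patchE.
case: ifPn => [/set_mem/SS'/mem_set ->//|_]; by case: ifP.
Qed.

Lemma gibbs_measurable (S : set tup) : measurable S ->
  gibbs mu A beta h S = (gibbs_mean \1_S)%:E.
Proof.
move=> mS; rewrite /gibbs integral_mkcond.
have bS := bmul (bounded_mfun_indic R Q mS).
have bSZ := bounded_mfunZ Z^-1 bS.
transitivity (\int[Pw]_x (Z^-1 * (\1_S x * expR (f x)))%:E)%E.
  apply: eq_integral => x _; rewrite patchE indicE.
  by case: ifP => _; rewrite ?mul1r ?mul0r ?mulr0// mulrC.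
have := integrable_fin_num measurableT (integrable_bounded_mfun mQ PQ bSZ).
move=> /fineK <-; congr (_%:E).
rewrite -[LHS]/(\int[Pw]_x (Z^-1 * (\1_S x * expR (f x)))).
by rewrite (bounded_RintegralZ mQ PQ)// mulrC.
Qed.

(** Made for events about the estimator, whose measurability is not established: their probability
    is bounded below through a measurable subset and a test function under its indicator. *)
Lemma gibbs_ge (S S' : set tup) (r : R) (phi : tup -> R) :
  measurable S -> S `<=` S' -> bounded_mfun Q phi ->
  (forall x, Q x -> phi x <= \1_S x) -> r <= gibbs_mean phi ->
  (r%:E <= gibbs mu A beta h S')%E.
Proof.
move=> mS SS' bphi hphi hr; apply: le_trans (le_gibbs SS').
rewrite gibbs_measurable// lee_fin; apply: le_trans hr _.
by apply: le_gibbs_mean => //; exact: bounded_mfun_indic.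
Qed.

Lemma gibbs_le1 S : (gibbs mu A beta h S <= 1)%E.
Proof.
apply: le_trans (le_gibbs (@subsetT _ S)) _; rewrite gibbs_measurable// lee_fin.
rewrite -[leRHS]gibbs_mean_cst; apply: le_gibbs_mean.
- exact: bounded_mfun_indic.
- exact: bounded_mfun_cst.
- by move=> x _; rewrite indicT.
Qed.

Let cmean i x := tilted_mean mu (beta * m x i + h).

Definition weighted_residual (w : 'I_N -> tup -> R) x :=
  \sum_i w i x * (tnth x i - cmean i x).

(** One constant dominating the sizes of the four weights (first four terms) and their oscillation
    constants (last two). *)
Definition weight_bound := 1 + gamma * M ^+ 2 + gamma * M + gamma +
  4 * M ^+ 2 + 2 * M.

Local Notation C := weight_bound.

Let Kl := `|beta| * (4 * M ^+ 2).

(** The constant of [residual_second_moment] for slopes [beta * m_i + h], whose oscillation constant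
    is [Kl]. *)
Definition residual_const : R := (2 * M * C) ^+ 2 +
  2 * M * C * (2 * M * C + C * (M ^+ 2 * (`|beta| * (4 * M ^+ 2)))) * gamma.

Definition admissible_weight (w : 'I_N -> tup -> R) :=
  [/\ forall i, bounded_mfun Q (w i), forall i x, Q x -> `|w i x| <= C,
      forall i x z, w i (upd x i z) = w i x &
      forall i j x z, Q x -> km <= z <= kp -> i != j ->
        `|w j (upd x i z) - w j x| <= C * pair_degree A i j].

Let C_terms : [/\ 0 <= C, 1 <= C, gamma * M ^+ 2 <= C, gamma * M <= C & gamma <= C]
  /\ 4 * M ^+ 2 <= C /\ 2 * M <= C.
Proof.
have h1 : 0 <= gamma * M ^+ 2 by rewrite mulr_ge0 ?exprn_ge0.
have h2 : 0 <= gamma * M by rewrite mulr_ge0.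
have h3 : 0 <= M ^+ 2 by rewrite exprn_ge0.
by move: M_ge0 gamma_ge0 => M0 g0; split; [split|split]; rewrite /C; lra.
Qed.

Let D0 := pair_degree_ge0 hA.

Lemma admissible_one : admissible_weight (fun _ _ => 1).
Proof.
have [[C0 C1 _ _ _] _] := C_terms.
split=> //= [i|i x _|i j x z *]; first exact: bounded_mfun_cst.
  by rewrite normr1.
by rewrite subrr normr0 mulr_ge0.
Qed.

Lemma admissible_local_field : admissible_weight (fun i x => m x i).
Proof.
have [[C0 _ CM _ _] [C4 _]] := C_terms.
split=> [i|i x Qx|i x z|i j x z Qx kz _].
- exact: bounded_mfun_local_field.
- by apply: le_trans CM; exact: (local_field_le hA hrow kmM kpM).
- exact: local_field_upd.
- apply: le_trans (local_field_osc hA kmM kpM _ _ Qx kz) _.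
  by rewrite ler_wpM2r.
Qed.

Lemma admissible_linear_field : admissible_weight (fun i x => linear_field A x i).
Proof.
have [[C0 _ _ CM _] [_ C2]] := C_terms.
split=> [i|i x Qx|i x z|i j x z Qx kz _].
- exact: bounded_mfun_linear_field.
- by apply: le_trans CM; exact: (linear_field_le hA hrow kmM kpM).
- exact: linear_field_upd.
- apply: le_trans (linear_field_osc hA kmM kpM _ _ Qx kz) _.
  by rewrite ler_wpM2r.
Qed.

Lemma admissible_degree : admissible_weight (fun i _ => degree A i).
Proof.
have [[C0 _ _ _ Cg] _] := C_terms.
split=> // [i|i x _|i j x z *]; first exact: bounded_mfun_cst.
  by rewrite ger0_norm ?degree_ge0// (le_trans _ Cg)// degree_le.
by rewrite subrr normr0 mulr_ge0.
Qed.

Lemma bounded_mfun_weighted_residual w :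
  admissible_weight w -> bounded_mfun Q (weighted_residual w).
Proof.
move=> [bw _ _ _]; apply: bounded_mfun_sum => i; apply: bounded_mfunM => //.
apply: bounded_mfunB => //; apply: (bounded_mfun_tilted_mean mu1 kmM kpM).
apply: bounded_mfunD; last exact: bounded_mfun_cst.
exact/bounded_mfunZ/bounded_mfun_local_field.
Qed.

Lemma weighted_residual_moment w : admissible_weight w ->
  gibbs_mean (fun x => weighted_residual w x ^+ 2) <= residual_const * N%:R.
Proof.
move=> [bw wC wu wo]; rewrite ler_pdivrMr ?partition_function_gt0//.
pose lam i (x : tup) := beta * m x i + h.
have blam i : bounded_mfun Q (lam i).
  apply: bounded_mfunD; last exact: bounded_mfun_cst.
  exact/bounded_mfunZ/bounded_mfun_local_field.
have lam_upd i x z : lam i (upd x i z) = lam i x by rewrite /lam local_field_upd.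
have Kl0 : 0 <= Kl by rewrite mulr_ge0 ?mulr_ge0 ?exprn_ge0.
have lam_osc i j x z : Q x -> km <= z <= kp -> i != j ->
    `|lam j (upd x i z) - lam j x| <= Kl * pair_degree A i j.
  move=> Qx kz _; rewrite /lam opprD addrACA subrr addr0 -mulrBr.
  rewrite normrM -mulrA ler_wpM2l//.
  exact: (local_field_osc hA kmM kpM).
exact: (residual_second_moment mu1 kmM kpM bounded_mfun_hamiltonian blam
  (fun i x z => hamiltonian_upd hA beta h x i z) lam_upd D0 hrow Kl0
  lam_osc (fun i => proj1 (bw i)) wC wu wo).
Qed.

(** Collecting the four squares lets a single Markov bound control all four residuals at once. *)
Definition residual_energy x :=
  weighted_residual (fun _ _ => 1) x ^+ 2 +
  weighted_residual (fun i x => m x i) x ^+ 2 +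
  weighted_residual (fun i x => linear_field A x i) x ^+ 2 +
  weighted_residual (fun i _ => degree A i) x ^+ 2.

Lemma bounded_mfun_residual_energy : bounded_mfun Q residual_energy.
Proof.
have b w : admissible_weight w -> bounded_mfun Q (fun x => weighted_residual w x ^+ 2).
  by move=> /bounded_mfun_weighted_residual; exact: bounded_mfunX.
apply: bounded_mfunD; last exact/b/admissible_degree.
apply: bounded_mfunD; last exact/b/admissible_linear_field.
apply: bounded_mfunD; last exact/b/admissible_local_field.
exact/b/admissible_one.
Qed.

Lemma residual_energy_mean :
  gibbs_mean residual_energy <= 4 * residual_const * N%:R.
Proof.
have b w : admissible_weight w -> bounded_mfun Q (fun x => weighted_residual w x ^+ 2).
  by move=> /bounded_mfun_weighted_residual; exact: bounded_mfunX.
have b1 := b _ admissible_one; have b2 := b _ admissible_local_field.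
have b3 := b _ admissible_linear_field; have b4 := b _ admissible_degree.
have b12 := bounded_mfunD b1 b2; have b123 := bounded_mfunD b12 b3.
rewrite /residual_energy (gibbs_meanD b123 b4) (gibbs_meanD b12 b3) (gibbs_meanD b1 b2).
have := weighted_residual_moment admissible_one.
have := weighted_residual_moment admissible_local_field.
have := weighted_residual_moment admissible_linear_field.
have := weighted_residual_moment admissible_degree.
by rewrite -mulrA; lra.
Qed.

Lemma weighted_residual_le x e : 0 <= e -> residual_energy x <= e ^+ 2 ->
  [/\ `|weighted_residual (fun _ _ => 1) x| <= e,
      `|weighted_residual (fun i x => m x i) x| <= e,
      `|weighted_residual (fun i x => linear_field A x i) x| <= e &
      `|weighted_residual (fun i _ => degree A i) x| <= e].
Proof.
move=> e0; rewrite /residual_energy.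
set a := weighted_residual _ x; set b := weighted_residual _ x.
set c := weighted_residual _ x; set d := weighted_residual _ x.
have le_norm u : u ^+ 2 <= e ^+ 2 -> `|u| <= e.
  by rewrite -[u ^+ 2]real_normK ?num_real// ler_sqr ?nnegrE.
have := sqr_ge0 a; have := sqr_ge0 b; have := sqr_ge0 c; have := sqr_ge0 d.
by move=> *; split; apply: le_norm; lra.
Qed.

(* When all local fields are close to [s], the conditional means are close to
   the constant [t]; the residuals then allow the spins to be replaced by [t]
   one factor at a time. *)
Lemma flat_field_energy x s e (t := tilted_mean mu (beta * s + h))
    (K := 1 + C * (M ^+ 2 * `|beta| * 2)) :
  Q x -> 0 <= e -> residual_energy x <= e ^+ 2 ->
  \sum_i `|m x i - s| <= 2 * e ->
  `|\sum_i tnth x i - t * N%:R| <= K * e /\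
  `|f x - hamiltonian A beta h [tuple t | _ < N]| <=
    (`|beta| * (1 + M + M ^+ 2) + `|h|) * (K * e).
Proof.
move=> Qx e0 he hs; have [W1 W2 W3 W4] := weighted_residual_le e0 he.
have [[C0 _ _ _ _] _] := C_terms.
have tM : `|t| <= M by exact: (tilted_mean_norm mu1 kmM kpM).
have hcm : \sum_i `|cmean i x - t| <= M ^+ 2 * `|beta| * (2 * e).
  apply: (@le_trans _ _ (\sum_i M ^+ 2 * `|beta| * `|m x i - s|)); last first.
    by rewrite -mulr_sumr ler_wpM2l// mulr_ge0 ?exprn_ge0.
  apply: ler_sum => i _; apply: le_trans (tilted_mean_Lipschitz mu1 kmM kpM _ _) _.
  by rewrite opprD addrACA subrr addr0 -mulrBr normrM mulrA.
(* Replacing [x_i] by [t] costs the residual, which passes from [x_i] to its conditional mean, plus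
   the distance of the conditional means from [t]. *)
have swap w : admissible_weight w -> `|weighted_residual w x| <= e ->
    `|\sum_i w i x * tnth x i - t * \sum_i w i x| <= K * e.
  move=> [_ wC _ _] We.
  have -> : \sum_i w i x * tnth x i - t * \sum_i w i x =
      weighted_residual w x + \sum_i w i x * (cmean i x - t).
    rewrite /weighted_residual -big_split/= mulr_sumr -sumrB.
    by apply: eq_bigr => i _; ring.
  apply: le_trans (ler_normD _ _) _; rewrite /K mulrDl mul1r lerD//.
  apply: le_trans (ler_norm_sum _ _ _) _.
  apply: (@le_trans _ _ (\sum_i C * `|cmean i x - t|)).
    by apply: ler_sum => i _; rewrite normrM ler_wpM2r// wC.
  by rewrite -mulr_sumr -mulrA ler_wpM2l// (le_trans hcm)// !mulrA.
have S1 := swap _ admissible_one W1; have S2 := swap _ admissible_local_field W2.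
have S3 := swap _ admissible_linear_field W3; have S4 := swap _ admissible_degree W4.
rewrite -(sum_local_field_linear hA) in S3.
rewrite -(sum_linear_field_degree hA) in S4.
have {}S1 : `|\sum_i tnth x i - t * N%:R| <= K * e.
  move: S1; rewrite sumr_const card_ord.
  by under eq_bigr do rewrite mul1r.
split=> //; rewrite hamiltonianE hamiltonian_const.
move: S1 S2 S3 S4; move: (K * e) (\sum_i m x i * _) (\sum_i m x i)
  (\sum_i linear_field A x i) (\sum_i degree A i) (\sum_i tnth x i) => k P q r S X.
move=> S1 S2 S3 S4; have k0 : 0 <= k by apply: le_trans S1.
have hP : `|P - t ^+ 3 * S| <= (1 + M + M ^+ 2) * k.
  (* Telescoping over the three spins of the cubic form; the powers of [t] produce the factor
     [1 + M + M ^+ 2]. *)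
  rewrite (_ : P - _ = (P - t * q) + t * (q - t * r) + t ^+ 2 * (r - t * S));
    last by ring.
  rewrite !mulrDl mul1r; apply: le_trans (ler_normD _ _) _; apply: lerD.
    apply: le_trans (ler_normD _ _) _; apply: lerD => //.
    by rewrite normrM ler_pM.
  by rewrite normrM ler_pM// normrX lerXn2r ?nnegrE.
rewrite (_ : _ - _ = beta / 3 * (P - t ^+ 3 * S) + h * (X - t * N%:R)); last by ring.
apply: le_trans (ler_normD _ _) _; rewrite mulrDl !normrM; apply: lerD; last first.
  by rewrite ler_wpM2l.
rewrite -[leRHS]mulrA -mulrA; apply: ler_wpM2l => //.
rewrite -[leRHS]mul1r; apply: ler_pM => //.
by rewrite normfV ger0_norm// invf_le1 ?ltr0n// ler1n.
Qed.

(** A point of infinite rate contributes [-oo]; at any other point [integral_expR_rate] applies with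
    the slopes [beta * m_i + h]. *)
Lemma mean_field_sup_le : (mean_field_sup mu A beta h (cube km kp (N := N)) <=
  (ln Z)%:E)%E.
Proof.
apply: ge_ereal_sup => _ [y _ <-].
(* The choice [l = 0] gives the value [0]. Nonnegativity leaves only finite or [+oo] for the sum of
   rates. *)
have ge0_rate t : (0 <= rate mu t)%E.
  apply: ereal_sup_ubound; exists 0 => //; rewrite mul0r sub0r.
  have -> : logmgf mu 0 = 0; last by rewrite oppr0.
  rewrite /logmgf; under eq_Rintegral do rewrite mul0r expR0.
  by rewrite Rintegral_prob_cst ln1.
have [fin|] := boolP ((\sum_i rate mu (tnth y i))%E \is a fin_num); last first.
  rewrite ge0_fin_numE ?sume_ge0// -leNgt leye_eq => /eqP ->.
  by rewrite leNye.
have finr i : rate mu (tnth y i) \is a fin_num.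
  by move: fin => /sum_fin_numP; apply; rewrite ?mem_index_enum.
pose r i := fine (rate mu (tnth y i)).
have -> : (\sum_i rate mu (tnth y i))%E = (\sum_i r i)%:E.
  by rewrite -sumEFin; apply: eq_bigr => i _; rewrite fineK.
have hr i l : l * tnth y i - logmgf mu l <= r i.
  by rewrite -lee_fin fineK//; apply: ereal_sup_ubound; exists l.
have := integral_expR_rate mu1 kmM kpM
  (proj1 bounded_mfun_hamiltonian) (lam := fun i x => beta * m x i + h)
  (fun i x z => hamiltonian_upd hA beta h x i z) hr.
have := integrable_fin_num measurableT (integrable_bounded_mfun mQ PQ be).
move=> /fineK ZE hZ; rewrite lee_fin -ler_expR lnK ?posrE ?partition_function_gt0//.
by rewrite -lee_fin (le_trans hZ)// -ZE.
Qed.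

End gibbs_model.

(** * Lower bound for the variance of the local fields *)

(** The number of grid points depends on [B] and [eta] only, so a union bound over the grid is
    uniform in [N]. *)
Lemma grid_cover (R : realType) (B eta u : R) : 0 < eta -> `|u| <= B ->
  exists k : 'I_(Num.truncn (2 * B / eta)).+1, `|u - (- B + k%:R * eta)| <= eta.
Proof.
move=> eta0; rewrite ler_norml => /andP[Bu uB].
have v0 : 0 <= (u + B) / eta by rewrite divr_ge0 ?(ltW eta0)//; lra.
have /andP[kv vk] := truncn_itv v0.
have kB : (Num.truncn ((u + B) / eta) < (Num.truncn (2 * B / eta)).+1)%N.
  by rewrite ltnS le_truncn// ler_pM2r ?invr_gt0//; lra.
exists (Ordinal kB) => /=.
move: kv vk; move: (Num.truncn _) => t; rewrite ler_pdivlMr// ltr_pdivrMr//.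
rewrite (_ : t.+1%:R = t%:R + 1); last by rewrite natr1.
by rewrite mulrDl mul1r ler_norml; lra.
Qed.

Lemma grid_norm (R : realType) (B eta : R) (k : 'I_(Num.truncn (2 * B / eta)).+1) :
  0 < eta -> 0 <= B -> `|- B + k%:R * eta| <= B.
Proof.
move=> eta0 B0; have k0 : 0 <= k%:R * eta by rewrite mulr_ge0 ?ler0n ?(ltW eta0).
have v0 : 0 <= 2 * B / eta by rewrite divr_ge0 ?(ltW eta0)// mulr_ge0.
suff : k%:R * eta <= 2 * B by rewrite ler_norml; lra.
rewrite -ler_pdivlMr//; have /andP[+ _] := truncn_itv v0; apply: le_trans.
by rewrite ler_nat -ltnS.
Qed.

Lemma expRN_le (R : realType) (u : R) : 0 < u -> expR (- u) <= u^-1.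
Proof.
move=> u0; rewrite expRN lef_pV2 ?posrE ?expR_gt0//.
by apply: le_trans (expR_ge1Dx u); rewrite lerDr.
Qed.

Section field_variance.
Context (R : realType) (N : nat).
Implicit Types y : 'I_N -> R.
Hypothesis N0 : (0 < N)%N.

Let N0R : 0 < N%:R :> R. Proof. by rewrite ltr0n. Qed.

Lemma sum_mean y : \sum_i y i = N%:R * mean y.
Proof. by rewrite /mean mulVKf// lt0r_neq0. Qed.

Lemma mean_norm y B : (forall i, `|y i| <= B) -> `|mean y| <= B.
Proof.
move=> yB; rewrite /mean normrM ger0_norm ?invr_ge0 ?ler0n// ler_pdivrMl//.
apply: le_trans (ler_norm_sum _ _ _) _.
apply: le_trans (ler_sum _ (fun i _ => yB i)) _.
by rewrite sumr_const card_ord mulr_natl.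
Qed.

(** An [L^2] to [L^1] comparison, obtained termwise from [2 * eta * |u| <= eta^2 + u^2]. *)
Lemma mean_abs_dev y eta : 0 < eta -> sqdev y <= N%:R * eta ^+ 2 ->
  \sum_i `|y i - mean y| <= N%:R * eta.
Proof.
move=> eta0 hT.
have amgm (u : R) : `|u| <= eta / 2 + u ^+ 2 / (2 * eta).
  rewrite -[u ^+ 2]real_normK ?num_real//; set v := `|u|.
  rewrite -subr_ge0 (_ : _ - _ = (eta - v) ^+ 2 / (2 * eta)); last first.
    by field; rewrite gt_eqF.
  by rewrite divr_ge0 ?sqr_ge0 ?mulr_ge0 ?ltW.
apply: le_trans (ler_sum _ (fun i _ => amgm (y i - mean y))) _.
rewrite big_split/= sumr_const card_ord -mulr_suml -/(sqdev y) -[_ *+ N]mulr_natl.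
apply: (@le_trans _ _ (N%:R * (eta / 2) + N%:R * eta ^+ 2 / (2 * eta))).
  by rewrite lerD2l ler_wpM2r// invr_ge0 mulr_ge0 ?(ltW eta0).
rewrite le_eqVlt; apply/orP; left; apply/eqP; field.
by rewrite gt_eqF.
Qed.

Lemma sqdev_const (t : R) : sqdev (fun _ : 'I_N => t) = 0.
Proof.
apply: big1 => i _; rewrite /mean sumr_const card_ord -[t *+ N]mulr_natl.
by rewrite mulKf ?lt0r_neq0// subrr expr0n.
Qed.

End field_variance.

Section field_variance_lower_bound.
Context (R : realType) (mu : probability (measurableTypeR R) R).
Variables (km kp M : R).
Hypotheses (mu1 : mu [set` `[km, kp]] = 1%E).
Hypotheses (kmM : `|km| <= M) (kpM : `|kp| <= M).
Variables (gamma beta h eps delta : R).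
Hypotheses (gamma_ge0 : 0 <= gamma) (eps_ge0 : 0 <= eps) (delta_gt0 : 0 < delta).

Let M_ge0 : 0 <= M. Proof. exact: le_trans kmM. Qed.

Definition mean_field_gap N (A : 'I_N -> 'I_N -> 'I_N -> R) :=
  (mean_field_sup mu A beta h
     [set y | cube km kp y /\ (sqdev (tnth y) <= eps * N%:R)%R]
   <= mean_field_sup mu A beta h (cube km kp (N := N)) - (delta * N%:R)%:E)%E.

(** The error factors of [flat_field_energy] for the spin sum and, in [energy_const], for the
    Hamiltonian. Then [field_bound] bounds the local fields and [tilt_bound] the tilts
    [beta * s + h] with [|s| <= field_bound]. *)
Definition swap_const := 1 + weight_bound M gamma * (M ^+ 2 * `|beta| * 2).

Definition energy_const := (`|beta| * (1 + M + M ^+ 2) + `|h|) * swap_const.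

Definition field_bound := gamma * M ^+ 2.

Definition tilt_bound := `|beta| * field_bound + `|h|.

Local Notation K := swap_const.
Local Notation K1 := energy_const.
Local Notation B := field_bound.
Local Notation L := tilt_bound.

Section fixed_size.
Variables (N : nat) (A : 'I_N -> 'I_N -> 'I_N -> R).
Hypotheses (N0 : (0 < N)%N) (hA : interaction_tensor A).
Hypothesis hrow : forall i, \sum_j \sum_k A i j k <= gamma.
Hypothesis gap : mean_field_gap A.

Local Notation tup := (N.-tuple (measurableTypeR R)).
Local Notation Q := (@cube R km kp N : set tup).
Local Notation f := (hamiltonian A beta h : tup -> R).
Local Notation Z := (partition_function mu A beta h).
Local Notation mean_g := (gibbs_mean mu A beta h).

(** A constant vector has no deviation, so it competes in the restricted supremum, where its rate is
    explicit because [t] is a tilted mean; the unrestricted supremum is at most [ln Z]. *)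
Lemma gap_const l (t := tilted_mean mu l) :
  f [tuple t | _ < N] - N%:R * (l * t - logmgf mu l) <= ln Z - delta * N%:R.
Proof.
pose y : tup := [tuple t | _ < N].
rewrite -lee_fin EFinB.
have <- : (\sum_i rate mu (tnth y i))%E = (N%:R * (l * t - logmgf mu l))%:E.
  rewrite (eq_bigr (fun=> (l * t - logmgf mu l)%:E)) => [|i _].
    by rewrite sumEFin sumr_const card_ord mulr_natl.
  by rewrite tnth_mktuple (rate_tilted_mean mu1 kmM kpM).
apply: (@le_trans _ _ (mean_field_sup mu A beta h
     [set y | cube km kp y /\ (sqdev (tnth y) <= eps * N%:R)%R])).
  apply: ereal_sup_ubound; exists y => //; split.
    by move=> i; rewrite tnth_mktuple; exact: tilted_mean_segment mu1 kmM kpM l.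
  rewrite (_ : sqdev _ = 0) ?mulr_ge0// -[RHS](sqdev_const N0 t).
  by congr sqdev; apply/funext => i; rewrite tnth_mktuple.
apply: le_trans gap _; rewrite EFinB leeB//.
exact: (mean_field_sup_le mu1 kmM kpM hA beta h).
Qed.

Lemma bounded_mfun_TN : bounded_mfun Q (TN A).
Proof.
apply: bounded_mfunZ; apply: bounded_mfun_sum => i; apply: bounded_mfunX.
have b := bounded_mfun_local_field kmM kpM A.
apply: bounded_mfunB => //; apply: bounded_mfunZ.
exact: bounded_mfun_sum.
Qed.

Lemma measurable_TN_ge c : measurable [set x : tup | c <= TN A x].
Proof.
have [mT _] := bounded_mfun_TN.
rewrite [X in measurable X](_ : _ = TN A @^-1` `[c, +oo[); last first.
  by apply/seteqP; split => x /=; rewrite in_itv/= andbT.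
by rewrite -[X in measurable X]setTI; apply: mT => //; exact: measurable_itv.
Qed.

(* Exponent of a Chernoff bound: nonnegative where the local fields are nearly
   constant, with exponentially small mean of its exponential. *)
Definition flat_exponent l e (x : tup) : R :=
  l * (\sum_i tnth x i) - f x + (f [tuple tilted_mean mu l | _ < N] -
    N%:R * (l * tilted_mean mu l) + (K1 + L * K) * e).

(** The term [- f x] cancels the Gibbs weight and leaves a product integral equal to
    [expR (N%:R * logmgf mu l)]; [gap_const] then compares the exponent with [ln Z]. *)
Lemma flat_exponent_mean l e :
  mean_g (fun x => expR (flat_exponent l e x)) <=
  expR ((K1 + L * K) * e - delta * N%:R).
Proof.
set F := f [tuple tilted_mean mu l | _ < N] -
  N%:R * (l * tilted_mean mu l) + (K1 + L * K) * e.
have mQ : measurable Q by exact: measurable_cube.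
have PQ : power_prob mu N Q = 1%E by exact: power_prob_cube.
have bt := bounded_mfun_tnth kmM kpM (N := N).
have bS : bounded_mfun Q (fun x => expR (l * \sum_i tnth x i)).
  by apply/bounded_mfun_expR/bounded_mfunZ; exact: bounded_mfun_sum.
have Z0 : 0 < Z by exact: (partition_function_gt0 mu1 kmM kpM).
rewrite /gibbs_mean (_ : \int[_]_x _ = expR F * expR (N%:R * logmgf mu l)).
  have ZE : Z = expR (ln Z) by rewrite lnK.
  rewrite -expRD ler_pdivrMr// [in leRHS]ZE.
  by rewrite -expRD ler_expR /F; have /= := gap_const l; rewrite mulrBr; lra.
transitivity (\int[power_prob mu N]_x (expR F * expR (l * \sum_i tnth x i))).
  apply: eq_Rintegral => x _; rewrite -!expRD; congr expR.
  by rewrite /flat_exponent -/F; ring.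
rewrite (bounded_RintegralZ mQ PQ)//; congr (_ * _).
by rewrite /Rintegral (integral_expR_sum mu1 kmM kpM).
Qed.

Lemma bounded_mfun_flat_exponent l e :
  bounded_mfun Q (fun x => expR (flat_exponent l e x)).
Proof.
have bt := bounded_mfun_tnth kmM kpM (N := N).
apply/bounded_mfun_expR/bounded_mfunD; last exact: bounded_mfun_cst.
apply: bounded_mfunB; last exact: (bounded_mfun_hamiltonian kmM kpM).
by apply: bounded_mfunZ; exact: bounded_mfun_sum.
Qed.

(** With [e = N * eta], [flat_field_energy] bounds the energy error by [K1 * e] and the error in the
    tilting term by [L * K * e]; the last term of [flat_exponent] pays for both. *)
Lemma flat_exponent_ge0 x s eta : Q x -> 0 < eta -> `|s| <= B ->
  TN A x <= eta ^+ 2 -> `|mean (local_field A x) - s| <= eta ->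
  residual_energy mu A beta h x <= (N%:R * eta) ^+ 2 ->
  0 <= flat_exponent (beta * s + h) (N%:R * eta) x.
Proof.
move=> Qx eta0 sB hT hs hV; set l := beta * s + h; set e := N%:R * eta.
have N0R : 0 < N%:R :> R by rewrite ltr0n.
have e0 : 0 <= e by rewrite mulr_ge0 ?ltW.
(* One [e] for the deviation of the fields from their mean, one for the distance of the mean from
   [s]. *)
have hdev : \sum_i `|local_field A x i - s| <= 2 * e.
  apply: (@le_trans _ _ (\sum_i (`|local_field A x i - mean (local_field A x)| + eta))).
    apply: ler_sum => i _; rewrite -(subrKA (mean (local_field A x))).
    by apply: le_trans (ler_normD _ _) _; rewrite lerD2l.
  rewrite big_split/= sumr_const card_ord -[eta *+ N]mulr_natl -/e.
  have hsd : sqdev (local_field A x) <= N%:R * eta ^+ 2 by rewrite -ler_pdivrMl.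
  by have := mean_abs_dev eta0 hsd; rewrite -/e; lra.
have [h1 h2] := flat_field_energy mu1 kmM kpM hA hrow gamma_ge0 Qx e0 hV hdev.
have lL : `|l| <= L.
  apply: le_trans (ler_normD _ _) _; rewrite /L normrM lerD2r.
  by rewrite ler_wpM2l.
have {}h1 : - (L * K * e) <= l * (\sum_i tnth x i) - N%:R * (l * tilted_mean mu l).
  have : `|l * (\sum_i tnth x i - tilted_mean mu l * N%:R)| <= L * K * e.
    by rewrite normrM -mulrA ler_pM.
  rewrite ler_norml => /andP[+ _]; congr (_ <= _); ring.
have {}h2 : f x - f [tuple tilted_mean mu l | _ < N] <= K1 * e.
  by rewrite /K1 -mulrA (le_trans (ler_norm _)).
rewrite /flat_exponent -/l [(K1 + L * K) * e]mulrDl.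
have aux (S P F G a b : R) : - b <= S - P -> F - G <= a ->
    0 <= S - F + (G - P + (a + b)) by lra.
exact: aux h1 h2.
Qed.

End fixed_size.

(* Off [TN >= eta^2] every local field is near a grid value, so either some
   residual is large or one of finitely many exponential bounds applies. *)
Lemma TN_lower_bound : exists2 c : R, 0 < c & exists C : R,
  forall N (A : 'I_N -> 'I_N -> 'I_N -> R), (0 < N)%N -> interaction_tensor A ->
    (forall i, \sum_j \sum_k A i j k <= gamma) -> mean_field_gap A ->
    1 - C / N%:R <= gibbs_mean mu A beta h \1_[set x | c <= TN A x].
Proof.
pose K2 := K1 + L * K.
have B0 : 0 <= B by rewrite mulr_ge0 ?exprn_ge0.
have K0 : 0 <= K.
  rewrite addr_ge0 ?mulr_ge0 ?exprn_ge0// /weight_bound.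
  by rewrite !addr_ge0 ?mulr_ge0 ?exprn_ge0.
have K20 : 0 <= K2.
  by rewrite addr_ge0// mulr_ge0// !addr_ge0 ?mulr_ge0 ?addr_ge0 ?exprn_ge0.
(* Small enough that the accumulated error [K2 * eta * N] uses up at most half of the gap
   [delta * N]. *)
pose eta := delta / (2 * (K2 + 1)).
have eta0 : 0 < eta by rewrite divr_gt0 ?mulr_gt0// ltr_wpDl.
have etaK : K2 * eta <= delta / 2.
  rewrite /eta mulrA ler_pdivrMr ?mulr_gt0 ?ltr_wpDl//.
  rewrite [leRHS](_ : _ = delta * (K2 + 1)); last by field.
  by rewrite mulrC ler_wpM2l ?(ltW delta_gt0)// lerDl.
clearbody eta; pose n := (Num.truncn (2 * B / eta)).+1.
exists (eta ^+ 2); first exact: exprn_gt0.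
(* The first term is the Markov bound for the residual energy at level [(N * eta)^2]; the second
   comes from [n] grid points, each contributing [expR (- (delta / 2 * N)) <= 2 / (delta * N)]. *)
exists (4 * residual_const M gamma beta / eta ^+ 2 + n%:R * (2 / delta)).
move=> N A N0 hA hrow gap.
have N0R : 0 < N%:R :> R by rewrite ltr0n.
pose s (k : 'I_n) : R := - B + k%:R * eta.
pose V (x : N.-tuple (measurableTypeR R)) :=
  (N%:R * eta) ^- 2 * residual_energy mu A beta h x.
pose E (k : 'I_n) x := expR (flat_exponent A (beta * s k + h) (N%:R * eta) x).
have bV0 := bounded_mfun_residual_energy mu1 kmM kpM hA beta h hrow gamma_ge0.
have bV := bounded_mfunZ ((N%:R * eta) ^- 2) bV0.
have bE k := bounded_mfun_flat_exponent A (beta * s k + h) (N%:R * eta).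
have bS := bounded_mfun_sum (index_enum 'I_n) bE.
pose Q := @cube R km kp N : set (N.-tuple (measurableTypeR R)).
have b1 := bounded_mfun_cst Q (1 : R).
have b1V := bounded_mfunB b1 bV.
(* On the cube the function [1 - V - \sum_k E k] lies below the indicator of the event, so its mean
   is a lower bound for the probability. *)
have mean_phi : 1 - (4 * residual_const M gamma beta / eta ^+ 2 +
      n%:R * (2 / delta)) / N%:R <=
    gibbs_mean mu A beta h (fun x => 1 - V x - \sum_k E k x).
  rewrite (gibbs_meanB mu1 kmM kpM A beta h b1V bS).
  rewrite (gibbs_meanB mu1 kmM kpM A beta h b1 bV).
  rewrite (gibbs_mean_cst mu1 kmM kpM) (gibbs_meanZ mu1 kmM kpM A beta h _ bV0).
  rewrite (gibbs_mean_sum mu1 kmM kpM A beta h _ bE).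
  rewrite -addrA lerD2l -opprD lerN2 mulrDl.
  apply: lerD.
    have Ne0 : 0 < (N%:R * eta) ^+ 2 by rewrite exprn_gt0 ?mulr_gt0.
    rewrite mulrC ler_pdivrMr//.
    apply: le_trans (residual_energy_mean mu1 kmM kpM hA beta h hrow gamma_ge0) _.
    rewrite le_eqVlt; apply/orP; left; apply/eqP; field.
    by rewrite !gt_eqF.
  rewrite -mulrA (_ : n%:R * _ = \sum_(k < n) (2 / delta / N%:R)); last first.
    by rewrite sumr_const card_ord mulr_natl.
  apply: ler_sum => k _; apply: le_trans (flat_exponent_mean N0 hA gap _ _) _.
  apply: (@le_trans _ _ (expR (- (delta / 2 * N%:R)))).
    rewrite ler_expR (mulrC N%:R) mulrA -mulrBl -mulNr ler_wpM2r ?ler0n//.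
    by rewrite -/K2; lra.
  apply: le_trans (expRN_le _) _; first by rewrite !mulr_gt0 ?invr_gt0.
  by rewrite le_eqVlt; apply/orP; left; apply/eqP; field; rewrite !gt_eqF.
apply: le_trans mean_phi _; apply: (le_gibbs_mean mu1 kmM kpM).
- exact: bounded_mfunB.
- apply: bounded_mfun_indic; exact: measurable_TN_ge.
move=> x Qx; rewrite indicE.
have V0 : 0 <= V x.
  rewrite mulr_ge0 ?invr_ge0 ?exprn_ge0 ?mulr_ge0 ?(ltW eta0)//.
  by rewrite !addr_ge0 ?sqr_ge0.
have E0 : 0 <= \sum_k E k x by apply: sumr_ge0 => k _; exact: expR_ge0.
case: (boolP (x \in _)) => [_|]; first by rewrite /=; lra.
rewrite notin_setE /= => /negP; rewrite -ltNge => /ltW hT.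
have [V1|V1] := leP 1 (V x); first by rewrite /=; lra.
have hV : residual_energy mu A beta h x <= (N%:R * eta) ^+ 2.
  move: V1; rewrite /V mulrC ltr_pdivrMr ?exprn_gt0 ?mulr_gt0// mul1r.
  exact: ltW.
have hm : `|mean (local_field A x)| <= B.
  by apply: (mean_norm N0) => i; exact: (local_field_le hA hrow kmM kpM).
have [k hk] := grid_cover eta0 hm.
have sB : `|s k| <= B by exact: grid_norm.
have hE : 1 <= E k x.
  rewrite -expR0 ler_expR.
  exact: (flat_exponent_ge0 N0 hA hrow Qx eta0 sB hT hk hV).
have : 1 <= \sum_k E k x.
  rewrite (bigD1 k)//= (le_trans hE)// lerDl.
  by apply: sumr_ge0 => j _; exact: expR_ge0.
by rewrite /=; lra.
Qed.

End field_variance_lower_bound.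

(** * The maximum pseudo-likelihood estimator *)

Section pseudo_likelihood.
Context (R : realType) (mu : probability (measurableTypeR R) R).
Variables (km kp M : R).
Hypotheses (mu1 : mu [set` `[km, kp]] = 1%E).
Hypotheses (kmM : `|km| <= M) (kpM : `|kp| <= M).
Hypotheses (kmkp : km < kp) (skm : msupport mu km) (skp : msupport mu kp).
Variables (N : nat) (m x : 'I_N -> R).
Hypothesis N0 : (0 < N)%N.

Local Notation tm := (tilted_mean mu).
Local Notation Lam := (logmgf mu).

Definition score_zero (p : R * R) :=
  \sum_i m i * (x i - tm (p.1 * m i + p.2)) = 0 /\
  \sum_i (x i - tm (p.1 * m i + p.2)) = 0.

(** Pairing the difference of the two scores with [p - q] gives a vanishing sum of terms that are
    nonnegative as [tilted_mean] is strictly increasing. All linear predictors then agree, and a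
    nonconstant [m] determines slope and intercept. *)
Lemma score_zero_unique p q : 0 < sqdev m -> score_zero p -> score_zero q -> p = q.
Proof.
move=> dev [p1 p2] [q1 q2].
pose a i := p.1 * m i + p.2; pose b i := q.1 * m i + q.2.
have tmon u v : 0 <= (tm u - tm v) * (u - v) /\
    ((tm u - tm v) * (u - v) = 0 -> u = v).
  have inc := tilted_mean_increasing mu1 kmM kpM kmkp skm skp.
  case: (ltgtP u v) => [uv|vu|->]; last by rewrite subrr mul0r.
    have h : 0 < (tm u - tm v) * (u - v) by rewrite nmulr_rgt0 subr_lt0 ?inc.
    by split=> [|h0]; [exact: ltW | rewrite h0 ltxx in h].
  have h : 0 < (tm u - tm v) * (u - v) by rewrite mulr_gt0 ?subr_gt0 ?inc.
  by split=> [|h0]; [exact: ltW | rewrite h0 ltxx in h].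
have {}p1 : \sum_i m i * (x i - tm (a i)) = 0 := p1.
have {}p2 : \sum_i (x i - tm (a i)) = 0 := p2.
have {}q1 : \sum_i m i * (x i - tm (b i)) = 0 := q1.
have {}q2 : \sum_i (x i - tm (b i)) = 0 := q2.
have aB i : a i - b i = (p.1 - q.1) * m i + (p.2 - q.2) by rewrite /a /b; ring.
have sum0 : \sum_i (tm (a i) - tm (b i)) * (a i - b i) = 0.
  transitivity ((p.1 - q.1) * (\sum_i m i * (x i - tm (b i)) -
      \sum_i m i * (x i - tm (a i))) +
    (p.2 - q.2) * (\sum_i (x i - tm (b i)) - \sum_i (x i - tm (a i)))).
    rewrite -!sumrB !mulr_sumr -big_split/=; apply: eq_bigr => i _.
    by rewrite aB; move: (tm _) (tm _) => ta tb; ring.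
  by rewrite q1 p1 q2 p2 !subrr !mulr0 addr0.
have eqab i : a i = b i.
  by apply: (tmon _ _).2; apply: (psumr_eq0P _ sum0) => // j _; exact: (tmon _ _).1.
have eq1 : p.1 = q.1.
  apply: contrapT => /eqP ne; move: dev; rewrite lt_neqAle => /andP[/negP[]].
  pose t := (q.2 - p.2) / (p.1 - q.1).
  have mE : m = fun=> t.
    apply/funext => i; have ne' : p.1 - q.1 != 0 by rewrite subr_eq0.
    apply: (mulfI ne'); rewrite /t [RHS]mulrC divfK//; have := aB i.
    by rewrite eqab subrr => /esym/eqP; rewrite addr_eq0 opprB => /eqP.
  by rewrite mE sqdev_const.
have eq2 : p.2 = q.2.
  by have := eqab (Ordinal N0); rewrite /a /b eq1 => /addrI.
by rewrite [p]surjective_pairing [q]surjective_pairing eq1 eq2.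
Qed.

Variables (B c k b0 h0 : R).
Hypotheses (mB : forall i, `|m i| <= B) (c0 : 0 < c) (k0 : 0 < k).
Hypothesis (devc : c * N%:R <= sqdev m).
Hypothesis var_ge : forall l,
  `|l| <= (`|b0| + 1) * B + (`|h0| + 1) -> k <= tilted_var mu l.

(** The negative log pseudo-likelihood relative to [mu]; its gradient is minus the score. *)
Definition pl_loss (p : R * R) :=
  \sum_i (Lam (p.1 * m i + p.2) - x i * (p.1 * m i + p.2)).

(** With [d = u * mean m + v] and [|mean m| <= B] one has [u^2 + v^2 <= (1 + 2 B^2) u^2 + 2 d^2],
    which is at most [c u^2 + d^2] divided by this constant. *)
Definition curvature (B c : R) := (2 + (1 + 2 * B ^+ 2) / c)^-1.

Let B0 : 0 <= B. Proof. exact: le_trans (mB (Ordinal N0)). Qed.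

Lemma curvature_gt0 : 0 < curvature B c.
Proof.
by rewrite invr_gt0 addr_gt0// divr_gt0// ltr_wpDr// mulr_ge0// sqr_ge0.
Qed.

(* Splitting [m] into mean and deviation turns the quadratic form into
   [u^2 sqdev m + N (u (mean m) + v)^2]. *)
Lemma sum_sqr_linear_ge u v :
  curvature B c * (u ^+ 2 + v ^+ 2) * N%:R <= \sum_i (u * m i + v) ^+ 2.
Proof.
have N0R : 0 < N%:R :> R by rewrite ltr0n.
pose a := mean m.
have -> : \sum_i (u * m i + v) ^+ 2 = u ^+ 2 * sqdev m + N%:R * (u * a + v) ^+ 2.
  have [w wE] : exists w, w = (u * a + v) ^+ 2 - 2 * u * (u * a + v) * a.
    by eexists.
  have e (i : 'I_N) : (u * m i + v) ^+ 2 = u ^+ 2 * (m i - a) ^+ 2 +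
      2 * u * (u * a + v) * m i + w by rewrite wE; ring.
  under eq_bigr do rewrite e.
  rewrite !big_split/= -!mulr_sumr sumr_const card_ord (sum_mean N0 m) -/a.
  by rewrite -[w *+ N]mulr_natl wE (_ : \sum_i (m i - a) ^+ 2 = sqdev m)//; ring.
have aB : `|a| <= B by exact: mean_norm.
have a2 : a ^+ 2 <= B ^+ 2.
  by rewrite -[a ^+ 2]real_normK ?num_real// lerXn2r ?nnegrE.
apply: (@le_trans _ _ (N%:R * (c * u ^+ 2 + (u * a + v) ^+ 2))); last first.
  rewrite mulrDr lerD2r [leLHS](_ : _ = u ^+ 2 * (c * N%:R)); last by ring.
  by rewrite ler_wpM2l ?sqr_ge0.
rewrite mulrC ler_pM2l// /curvature ler_pdivrMl; last first.
  by rewrite -invr_gt0 curvature_gt0.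
set d := u * a + v.
have v2 : v ^+ 2 <= 2 * d ^+ 2 + 2 * B ^+ 2 * u ^+ 2.
  have := sqr_ge0 (d + u * a).
  have : u ^+ 2 * a ^+ 2 <= u ^+ 2 * B ^+ 2 by rewrite ler_wpM2l ?sqr_ge0.
  have -> : v = d - u * a by rewrite /d; ring.
  by clearbody d; nra.
have E0 : 0 <= 1 + 2 * B ^+ 2 by rewrite addr_ge0// mulr_ge0 ?sqr_ge0.
have h1 : (1 + 2 * B ^+ 2) / c * (c * u ^+ 2) = (1 + 2 * B ^+ 2) * u ^+ 2.
  by field; rewrite gt_eqF.
have h2 : 0 <= (1 + 2 * B ^+ 2) / c * d ^+ 2.
  by rewrite mulr_ge0 ?sqr_ge0// divr_ge0// ltW.
have h3 : 0 <= c * u ^+ 2 by rewrite mulr_ge0 ?sqr_ge0// ltW.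
rewrite mulrDl 2![in leRHS]mulrDr h1.
by move: v2 h2 h3; lra.
Qed.

(** A second-order lower bound for each summand; increments of size at most [1] keep all linear
    predictors in the range where [var_ge] applies. *)
Lemma pl_loss_ge u v : `|u| <= 1 -> `|v| <= 1 ->
  pl_loss (b0, h0)
  - (u * \sum_i m i * (x i - tm (b0 * m i + h0)) +
     v * \sum_i (x i - tm (b0 * m i + h0)))
  + k / 2 * (curvature B c * (u ^+ 2 + v ^+ 2) * N%:R)
  <= pl_loss (b0 + u, h0 + v).
Proof.
move=> u1 v1; apply: (@le_trans _ _ (pl_loss (b0, h0)
  - (u * \sum_i m i * (x i - tm (b0 * m i + h0)) +
     v * \sum_i (x i - tm (b0 * m i + h0)))
  + k / 2 * \sum_i (u * m i + v) ^+ 2)).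
  by rewrite lerD2l ler_wpM2l ?sum_sqr_linear_ge// divr_ge0 ?(ltW k0).
rewrite /pl_loss/= !mulr_sumr -big_split -sumrB -big_split/=.
apply: ler_sum => i _.
have bm := mB i.
have aL : `|b0 * m i + h0| <= (`|b0| + 1) * B + (`|h0| + 1).
  apply: le_trans (ler_normD _ _) _; apply: lerD; last by rewrite lerDl.
  by rewrite normrM ler_pM// lerDl.
have bL : `|(b0 + u) * m i + (h0 + v)| <= (`|b0| + 1) * B + (`|h0| + 1).
  apply: le_trans (ler_normD _ _) _; apply: lerD.
    rewrite normrM ler_pM//; apply: le_trans (ler_normD _ _) _.
    by rewrite lerD2l.
  by apply: le_trans (ler_normD _ _) _; rewrite lerD2l.
have := strongly_convex_tangent (is_derive_logmgf mu1 kmM kpM)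
  (is_derive_tilted_mean mu1 kmM kpM) var_ge aL bL.
rewrite (_ : (b0 + u) * m i + (h0 + v) - (b0 * m i + h0) = u * m i + v); last by ring.
move: (Lam _) (Lam _) (tm _) => p q t hpq.
rewrite -lerBrDr in hpq; rewrite -lerBrDr.
rewrite -subr_ge0; move: hpq; rewrite -subr_ge0; congr (_ <= _); ring.
Qed.

Lemma continuous_pl_loss : continuous pl_loss.
Proof.
have cL : continuous Lam.
  move=> l; apply/differentiable_continuous/derivable1_diffP.
  by have [] := is_derive_logmgf mu1 kmM kpM l.
move=> p; rewrite /pl_loss.
apply: cvg_big => [|i _]; first exact: add_continuous.
have cl : (fun q : R * R => q.1 * m i + q.2) @ p --> p.1 * m i + p.2.
  apply: cvgD; last exact: cvg_snd.
  by apply: cvgM; [exact: cvg_fst | exact: cvg_cst].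
apply: cvgB; last by apply: cvgM; [exact: cvg_cst |].
exact: (cvg_comp _ _ cl (cL _)).
Qed.

Lemma is_derive_pl_loss1 (b h : R) : is_derive b 1 (fun t => pl_loss (t, h))
  (- \sum_i m i * (x i - tm (b * m i + h))).
Proof.
rewrite /pl_loss/= -sumrN.
rewrite (_ : (fun _ => _) = \sum_i (fun t => Lam (t * m i + h) -
  x i * (t * m i + h))); last by rewrite fct_sumE.
apply: is_derive_sum => i.
have lin : is_derive b 1 (fun t => t * m i + h) (m i).
  by apply: is_derive_eq; rewrite /GRing.scale/=; ring.
have := is_deriveB (is_derive1_comp (is_derive_logmgf mu1 kmM kpM _) lin)
  (is_deriveZ (x i) lin).
by move=> /is_derive_eq; apply; rewrite /GRing.scale/=; ring.
Qed.

Lemma is_derive_pl_loss2 (b h : R) : is_derive h 1 (fun t => pl_loss (b, t))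
  (- \sum_i (x i - tm (b * m i + h))).
Proof.
rewrite /pl_loss/= -sumrN.
rewrite (_ : (fun _ => _) = \sum_i (fun t => Lam (b * m i + t) -
  x i * (b * m i + t))); last by rewrite fct_sumE.
apply: is_derive_sum => i.
have lin : is_derive h 1 (fun t => b * m i + t) 1.
  by apply: is_derive_eq; rewrite /GRing.scale/=; ring.
have := is_deriveB (is_derive1_comp (is_derive_logmgf mu1 kmM kpM _) lin)
  (is_deriveZ (x i) lin).
by move=> /is_derive_eq; apply; rewrite /GRing.scale/=; ring.
Qed.

(** A minimizer of the loss over the closed square of half-side [r] exists by compactness. Curvature
    forces it into the open disc of radius [r], hence into the interior, where both partial
    derivatives vanish. *)
Lemma score_zero_near e r : 0 < r <= 1 ->
  4 * e < k * curvature B c * N%:R * r ->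
  `|\sum_i m i * (x i - tm (b0 * m i + h0))| <= e ->
  `|\sum_i (x i - tm (b0 * m i + h0))| <= e ->
  exists p, [/\ score_zero p, `|p.1 - b0| <= r & `|p.2 - h0| <= r].
Proof.
move=> /andP[r0 r1] her g1 g2.
pose S : set (R * R) := `[b0 - r, b0 + r] `*` `[h0 - r, h0 + r].
have cS : compact S by apply: compact_setX; exact: segment_compact.
have S0 : S !=set0.
  by exists (b0, h0); split; rewrite /= in_itv/=; apply/andP; split; lra.
have cF : {within S, continuous pl_loss}.
  exact/continuous_subspaceT/continuous_pl_loss.
have [[b h]] := compact_EVT_min S0 cS cF.
rewrite inE /S/= !in_itv/= => -[bS hS] minF.
pose u := b - b0; pose v := h - h0.
have ur : `|u| <= r by rewrite ler_norml /u; lra.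
have vr : `|v| <= r by rewrite ler_norml /v; lra.
have bE : b = b0 + u by rewrite /u; ring.
have hE : h = h0 + v by rewrite /v; ring.
have min0 : pl_loss (b, h) <= pl_loss (b0, h0).
  by apply: minF; rewrite inE; split; rewrite /= in_itv/=; apply/andP; split; lra.
(* Otherwise the quadratic gain, at least [k / 2 * curvature B c * N * r^2], would exceed the linear
   loss, at most [2 * r * e]; this accounts for the factor [4] in the hypothesis. *)
have small : u ^+ 2 + v ^+ 2 < r ^+ 2.
  rewrite ltNge; apply/negP => big.
  have := pl_loss_ge (le_trans ur r1) (le_trans vr r1).
  rewrite -bE -hE => /le_trans/(_ min0).
  set G1 := \sum_i m i * _ in g1 *; set G2 := \sum_i _ in g2 *.
  have l1 : u * G1 <= r * e.
    by apply: le_trans (ler_norm _) _; rewrite normrM ler_pM.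
  have l2 : v * G2 <= r * e.
    by apply: le_trans (ler_norm _) _; rewrite normrM ler_pM.
  have q0 := curvature_gt0.
  have kN : 0 <= k / 2 * (curvature B c) * N%:R.
    by rewrite mulr_ge0 ?ler0n// mulr_ge0 ?divr_ge0// ltW.
  have l3 : k / 2 * curvature B c * N%:R * r ^+ 2 <=
      k / 2 * (curvature B c * (u ^+ 2 + v ^+ 2) * N%:R).
    rewrite [leRHS](_ : _ = k / 2 * curvature B c * N%:R * (u ^+ 2 + v ^+ 2));
      last by ring.
    by rewrite ler_wpM2l.
  have l4 : 2 * (r * e) < k / 2 * curvature B c * N%:R * r ^+ 2.
    have := her; rewrite -(ltr_pM2l r0).
    by rewrite (_ : k / 2 * _ * _ * _ = (r * (k * curvature B c * N%:R * r)) / 2);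
      [lra | field].
  by lra.
have lt_r w z : w ^+ 2 + z ^+ 2 < r ^+ 2 -> - r < w < r.
  move=> wz; rewrite -ltr_norml -(@ltr_pXn2r _ 2) ?nnegrE ?(ltW r0)//.
  rewrite real_normK ?num_real//; apply: le_lt_trans wz.
  by rewrite lerDl sqr_ge0.
have bI : b \in `]b0 - r, b0 + r[.
  by have := lt_r u v small; rewrite in_itv/= /u; lra.
have hI : h \in `]h0 - r, h0 + r[.
  by have := lt_r v u _; rewrite addrC in_itv/= => /(_ small); rewrite /v; lra.
exists (b, h); split => //; split => /=.
- have d1 := is_derive_pl_loss1 b h.
  have d0 : is_derive b 1 (fun t => pl_loss (t, h)) 0.
    apply: (derive1_at_min _ _ bI); first lra.
      by move=> t _; have [] := is_derive_pl_loss1 t h.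
    move=> t; rewrite in_itv/= => /andP[t1 t2]; apply: minF; rewrite inE; split=> //=.
    by rewrite in_itv/= !ltW.
  by apply/eqP; rewrite -oppr_eq0; apply/eqP; have [_ <-] := d1; have [_ ->] := d0.
- have d1 := is_derive_pl_loss2 b h.
  have d0 : is_derive h 1 (fun t => pl_loss (b, t)) 0.
    apply: (derive1_at_min _ _ hI); first lra.
      by move=> t _; have [] := is_derive_pl_loss2 b t.
    move=> t; rewrite in_itv/= => /andP[t1 t2]; apply: minF; rewrite inE; split=> //=.
    by rewrite in_itv/= !ltW.
  by apply/eqP; rewrite -oppr_eq0; apply/eqP; have [_ <-] := d1; have [_ ->] := d0.
Qed.

End pseudo_likelihood.

(** * Rate of the estimator for a fixed good configuration *)

Section mple_rate.
Context (R : realType) (mu : probability (measurableTypeR R) R).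
Variables (km kp M : R).
Hypotheses (mu1 : mu [set` `[km, kp]] = 1%E).
Hypotheses (kmM : `|km| <= M) (kpM : `|kp| <= M).
Hypotheses (kmkp : km < kp) (skm : msupport mu km) (skp : msupport mu kp).

Lemma pl_equationsE N (A : 'I_N -> 'I_N -> 'I_N -> R) x p :
  pl_equations mu A x p = score_zero mu (local_field A x) (tnth x) p.
Proof. by rewrite /pl_equations (derive1_logmgf mu1 kmM kpM). Qed.

Lemma mple_spec N (A : 'I_N -> 'I_N -> 'I_N -> R) x p :
  (0 < N)%N -> 0 < sqdev (local_field A x) ->
  score_zero mu (local_field A x) (tnth x) p ->
  mple_exists mu A x /\ mple mu A x = p.
Proof.
move=> N0 dev sp.
have up : unique (pl_equations mu A x) p.
  split=> [|q]; rewrite !pl_equationsE// => sq.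
  exact: (score_zero_unique mu1 kmM kpM kmkp skm skp N0 dev sp sq).
split; first by exists p.
(* A unique solution exists, so [xget] does not return its default [(0, 0)]. *)
have ex : exists p, [set p | unique (pl_equations mu A x) p] p by exists p.
have [e1 _] := xgetPex (0, 0) ex.
by rewrite /mple (up.2 _ e1).
Qed.

Variables (gamma beta h c : R).
Hypothesis c0 : 0 < c.

(** The deterministic half of consistency: [score_zero_near] is applied at radius [K' / sqrt N] with
    gradient bound [K * sqrt N]. *)
Lemma mple_close (K : R) : 0 <= K -> exists2 K' : R, 0 < K' &
  forall N (A : 'I_N -> 'I_N -> 'I_N -> R) (x : N.-tuple (measurableTypeR R)),
    (0 < N)%N -> interaction_tensor A ->
    (forall i, \sum_j \sum_k A i j k <= gamma) -> K' ^+ 2 <= N%:R ->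
    cube km kp x -> c <= TN A x ->
    residual_energy mu A beta h x <= K ^+ 2 * N%:R ->
  mple_exists mu A x /\
  Num.max `|(mple mu A x).1 - beta| `|(mple mu A x).2 - h| <=
    K' * (Num.sqrt N%:R)^-1.
Proof.
move=> K0; pose B := gamma * M ^+ 2.
have [k k0 hk] := tilted_var_lower mu1 kmM kpM kmkp skm skp
  ((`|beta| + 1) * B + (`|h| + 1)).
pose q := curvature B c.
have q0 : 0 < q.
  by rewrite invr_gt0 addr_gt0// divr_gt0// ltr_wpDr// mulr_ge0// sqr_ge0.
have kq0 : 0 < k * q by exact: mulr_gt0.
(* At radius [K' / sqrt N] the curvature term is [(4 * K + 1) * sqrt N], just above the required
   [4 * K * sqrt N]; the condition [K' ^+ 2 <= N] makes the radius at most [1]. *)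
pose K' := (4 * K + 1) / (k * q).
have K'0 : 0 < K' by rewrite divr_gt0// ltr_wpDl// mulr_ge0.
exists K' => // N A x N0 hA hrow KN Qx hT hV.
have N0R : 0 < N%:R :> R by rewrite ltr0n.
have s0 : 0 < Num.sqrt (N%:R : R) by rewrite sqrtr_gt0.
have ss : Num.sqrt (N%:R : R) ^+ 2 = N%:R by rewrite sqr_sqrtr ?ltW.
have e0 : 0 <= K * Num.sqrt N%:R by rewrite mulr_ge0 ?sqrtr_ge0.
have hV' : residual_energy mu A beta h x <= (K * Num.sqrt N%:R) ^+ 2.
  by rewrite exprMn ss.
have [W1 W2 _ _] := weighted_residual_le e0 hV'.
have dev : c * N%:R <= sqdev (local_field A x).
  by rewrite mulrC -ler_pdivlMl.
have dev0 : 0 < sqdev (local_field A x) by apply: lt_le_trans dev; exact: mulr_gt0.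
have mB i : `|local_field A x i| <= B by exact: (local_field_le hA hrow kmM kpM).
have r01 : 0 < K' * (Num.sqrt N%:R)^-1 <= 1.
  rewrite mulr_gt0 ?invr_gt0//= ler_pdivrMr// mul1r.
  by rewrite -(@ler_pXn2r _ 2) ?nnegrE ?(ltW K'0) ?sqrtr_ge0// ss.
have her : 4 * (K * Num.sqrt N%:R) < k * q * N%:R * (K' * (Num.sqrt N%:R)^-1).
  have -> : k * q * N%:R * (K' * (Num.sqrt N%:R)^-1) = (4 * K + 1) * Num.sqrt N%:R.
    rewrite /K'; move: ss s0; move: (Num.sqrt N%:R) => s <- s_gt0; field.
    by rewrite !gt_eqF.
  by rewrite mulrA ltr_pM2r// ltrDl.
have W1' : `|\sum_i (tnth x i - tilted_mean mu (beta * local_field A x i + h))| <=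
    K * Num.sqrt N%:R.
  by move: W1; rewrite /weighted_residual; under eq_bigr do rewrite mul1r.
have [p [sp p1 p2]] := score_zero_near mu1 kmM kpM N0 mB c0 k0 dev hk r01 her W2 W1'.
have [ex ->] := mple_spec N0 dev0 sp.
by split=> //; rewrite ge_max p1 p2.
Qed.

End mple_rate.

(** * From bounds at fixed [N] to convergence in probability *)

Lemma cvg_to_one (R : realType) (u : nat -> \bar R) :
  (forall n, (u n <= 1)%E) ->
  (forall eta : R, 0 < eta -> \forall n \near \oo, ((1 - eta)%:E <= u n)%E) ->
  u n @[n --> \oo] --> 1%E.
Proof.
move=> u1 hu; have ufin : \forall n \near \oo, u n \is a fin_num.
  near=> n; rewrite fin_numE; apply/andP; split.
    have : ((1 - 1)%:E <= u n)%E by near: n; exact: hu.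
    by apply: contraTN => /eqP ->.
  by apply/eqP => un; have := u1 n; rewrite un.
apply/fine_cvgP; split => //; apply/cvgrPdist_le => e e0; near=> n.
have un : u n \is a fin_num by near: n.
have h1 : fine (u n) <= 1 by rewrite -lee_fin fineK.
have h2 : 1 - e <= fine (u n) by rewrite -lee_fin fineK//; near: n; exact: hu.
by rewrite /= ger0_norm ?subr_ge0//; lra.
Unshelve. all: by end_near. Qed.

Theorem theorem1p11 (R : realType) (km kp : R) (hk : km < kp)
    (mu : probability (measurableTypeR R) R)
    (hmu : mu [set` `[km, kp]] = 1%E)
    (hkm : msupport mu km) (hkp : msupport mu kp)
    (A : forall N, 'I_N -> 'I_N -> 'I_N -> R)
    (hA : forall N, interaction_tensor (A N))
    (beta0 h0 : R)
    (gamma : R) (hgamma : 0 < gamma)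
    (hrow : forall N (i : 'I_N), \sum_j \sum_k A N i j k <= gamma)
    (hmf : (fun N : nat => opnorm (\sum_i slice (A N) i ^+ 2) : R^o)
             =o_\oo (fun N : nat => (ln N%:R)^-1 : R^o))
    (eps delta : R) (heps : 0 < eps) (hdelta : 0 < delta)
    (hgap : \forall N \near \oo,
      (mean_field_sup mu (A N) beta0 h0
         [set y | cube km kp y /\ (sqdev (tnth y) <= eps * N%:R)%R]
       <= mean_field_sup mu (A N) beta0 h0 (cube km kp (N := N))
          - (delta * N%:R)%:E)%E) :
  (exists2 c : R, 0 < c &
     gibbs mu (A N) beta0 h0 [set x | c <= TN (A N) x] @[N --> \oo] --> 1%E) /\
  mple_sqrt_consistent mu A beta0 h0.
Proof.
pose M := Num.max `|km| `|kp|.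
have kmM : `|km| <= M by rewrite le_max lexx.
have kpM : `|kp| <= M by rewrite le_max lexx orbT.
have g0 := ltW hgamma.
have [c c0 [C hC]] := TN_lower_bound hmu kmM kpM beta0 h0 g0 (ltW heps) hdelta.
have large (r : R) : \forall N \near \oo, r <= N%:R by exact: nbhs_infty_ger.
have hTN (eta : R) : 0 < eta -> \forall N \near \oo, (0 < N)%N /\
    1 - eta <= gibbs_mean mu (A N) beta0 h0 \1_[set x | c <= TN (A N) x].
  move=> eta0; near=> N.
  have N0 : (0 < N)%N by near: N; exact: nbhs_infty_gt.
  split=> //; apply: le_trans (hC N (A N) N0 (hA N) (@hrow N) _); last first.
    by near: N.
  rewrite lerD2l lerN2 ler_pdivrMr ?ltr0n// mulrC -ler_pdivrMr//.
  by near: N; exact: large.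
(* Existence and rate are kept in one event, from which both halves of consistency follow by
   monotonicity. *)
have key (eta : R) : 0 < eta -> exists2 K : R, 0 < K & \forall N \near \oo,
    ((1 - eta)%:E <= gibbs mu (A N) beta0 h0 [set x | mple_exists mu (A N) x /\
      (Num.max `|(mple mu (A N) x).1 - beta0| `|(mple mu (A N) x).2 - h0| <=
        K * (Num.sqrt N%:R)^-1)%R])%E.
  move=> eta0; pose RC := residual_const M gamma beta0.
  (* Markov at level [K^2 * N] leaves [4 * RC / K^2], which is at most [eta / 2] since [K >= 1] and
     [K * eta / 2 >= 4 * |RC|]. *)
  pose K := 8 * `|RC| / eta + 1.
  have K1 : 1 <= K by rewrite lerDr divr_ge0 ?mulr_ge0 ?(ltW eta0).
  have K0 : 0 < K by exact: lt_le_trans K1.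
  have [K' K'0 hK'] :=
    mple_close hmu kmM kpM hk hkm hkp gamma beta0 h0 c0 (ltW K0).
  exists K' => //; near=> N.
  have [N0 hN] : (0 < N)%N /\
      1 - eta / 2 <= gibbs_mean mu (A N) beta0 h0 \1_[set x | c <= TN (A N) x].
    by near: N; apply: hTN; rewrite divr_gt0.
  have KN : K' ^+ 2 <= N%:R by near: N; exact: large.
  have N0R : 0 < N%:R :> R by rewrite ltr0n.
  have KN0 : 0 < K ^+ 2 * N%:R by rewrite mulr_gt0 ?exprn_gt0.
  pose Q := @cube R km kp N : set (N.-tuple (measurableTypeR R)).
  pose V := residual_energy mu (A N) beta0 h0.
  have mQ : measurable Q by exact: measurable_cube.
  have bV : bounded_mfun Q V :=
    bounded_mfun_residual_energy hmu kmM kpM (hA N) beta0 h0 (@hrow N) g0.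
  have mT : measurable [set x : N.-tuple (measurableTypeR R) | c <= TN (A N) x].
    exact: (measurable_TN_ge kmM kpM).
  have mV : measurable [set x | V x <= K ^+ 2 * N%:R].
    rewrite (_ : mkset _ = V @^-1` `]-oo, K ^+ 2 * N%:R]).
      by rewrite -[X in measurable X]setTI; apply: bV.1 => //; exact: measurable_itv.
    by apply/seteqP; split => x /=; rewrite in_itv.
  pose T : set (N.-tuple (measurableTypeR R)) := [set x | c <= TN (A N) x].
  pose S := Q `&` (T `&` [set x | V x <= K ^+ 2 * N%:R]).
  (* Markov's inequality in test-function form: [phi] is nonpositive where [V] exceeds its level,
     and so lies below the indicator of [S] on the cube. *)
  pose phi x := \1_T x - (K ^+ 2 * N%:R)^-1 * V x.
  have bT : bounded_mfun Q (\1_T : _ -> R) by exact: bounded_mfun_indic.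
  have bKV := bounded_mfunZ (K ^+ 2 * N%:R)^-1 bV.
  apply: (gibbs_ge hmu kmM kpM (S := S) (phi := phi)).
  - by apply: measurableI => //; exact: measurableI.
  - by move=> x [Qx [hT hV]]; exact: hK'.
  - exact: bounded_mfunB.
  - move=> x Qx; rewrite /phi !indicE.
    have V0 : 0 <= V x by rewrite !addr_ge0 ?sqr_ge0.
    have KV0 : 0 <= (K ^+ 2 * N%:R)^-1 * V x by rewrite mulr_ge0 ?invr_ge0 ?(ltW KN0).
    have [/set_mem hT|_] := boolP (x \in T); last first.
      by apply: (@le_trans _ _ 0); [rewrite sub0r oppr_le0 | case: (_ \in _)].
    have [hV|hV] := leP (V x) (K ^+ 2 * N%:R).
      by rewrite mem_set ?lerBlDr ?lerDl//; split.
    apply: (@le_trans _ _ 0); last by case: (_ \in _).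
    by rewrite subr_le0 mulrC ler_pdivlMr// mul1r ltW.
  - rewrite (gibbs_meanB hmu kmM kpM (A N) beta0 h0 bT bKV).
    rewrite (gibbs_meanZ hmu kmM kpM (A N) beta0 h0 _ bV).
    have hE := residual_energy_mean hmu kmM kpM (hA N) beta0 h0 (@hrow N) g0.
    have : (K ^+ 2 * N%:R)^-1 * gibbs_mean mu (A N) beta0 h0 V <= eta / 2.
      rewrite ler_pdivrMl//; apply: le_trans hE _.
      rewrite [leRHS]mulrAC ler_wpM2r ?ler0n//.
      apply: (@le_trans _ _ (K * (eta / 2))); last first.
        by rewrite ler_wpM2r ?divr_ge0 ?(ltW eta0)// expr2 ler_peMl// ltW.
      have -> : K * (eta / 2) = 4 * `|RC| + eta / 2
        by rewrite /K; field; rewrite gt_eqF.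
      by rewrite ler_wpDr ?divr_ge0 ?(ltW eta0)// ler_wpM2l// ler_norm.
    by move: hN; rewrite -/T; lra.
have le1 N S := gibbs_le1 hmu kmM kpM (A N) beta0 h0 S.
split; [|split].
- exists c => //; apply: cvg_to_one => // eta eta0; near=> N.
  rewrite (gibbs_measurable hmu kmM kpM) ?lee_fin; last first.
    exact: (measurable_TN_ge kmM kpM).
  by apply: (proj2 (_ : (0 < N)%N /\ _)); near: N; exact: hTN.
- apply: cvg_to_one => // eta eta0; have [K K0 hK] := key _ eta0.
  apply: filterS hK => N; move=> /le_trans; apply.
  by apply: (le_gibbs hmu kmM kpM) => x [].
- move=> eta eta0; have [K K0 hK] := key _ eta0; exists K => //.
  apply: filterS hK => N; move=> /le_trans; apply.
  apply: (le_gibbs hmu kmM kpM) => x [_ hx] /=.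
  by rewrite ger0_norm// le_max normr_ge0.
Unshelve. all: by end_near. Qed.
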